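(* The isomorphism class $\langle C(\mathbb{R})\rangle=\{X\in\mathrm{SF}\mid X\cong C(\mathbb{R})\}$ is complete analytic in $\mathrm{SF}$.
   Context: $C(\mathbb{R})$ is the Fréchet space of continuous real-valued functions on $\mathbb{R}$ with the topology of uniform convergence on compact sets. $\mathrm{SF}=\{X\subseteq C(\mathbb{R})\mid X\text{ is a closed vector subspace}\}$ with the Effros Borel structure, i.e., the $\sigma$-algebra generated by the sets $\{X\in\mathrm{SF}\mid X\cap U\neq\emptyset\}$, $U\subseteq C(\mathbb{R})$ open; it is a standard Borel space. $\cong$ denotes linear isomorphism (linear homeomorphism). A subset $A$ of a standard Borel space $S$ is complete analytic ($\Sigma^1_1$-complete) if it is analytic and for every Polish space $Z$ and every analytic $B\subseteq Z$ there is a Borel map $f\colon Z\to S$ with $f^{-1}(A)=B$. *)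

(* Defs.v *)
From HB Require Import structures.
From mathcomp Require Import all_boot all_order all_algebra.
From mathcomp Require Import all_classical all_reals all_analysis.

Set Implicit Arguments.
Unset Strict Implicit.
Unset Printing Implicit Defensive.

Import Order.TTheory GRing.Theory Num.Theory.
Import numFieldNormedType.Exports.
Local Open Scope classical_set_scope.
Local Open Scope ring_scope.

Section ContR.
Variable R : realType.

Definition contR := continuousType R R.

HB.instance Definition _ := Choice.on contR.

Let toC (f : R -> R) (cf : continuous f) : contR := mkcts cf.

Let add_cts (f g : contR) : continuous (f \+ g : R -> R).
Proof. by move=> x; apply: cvgD; exact: cts_fun. Qed.

Let opp_cts (f : contR) : continuous (\- f : R -> R).
Proof. by move=> x; apply: cvgN; exact: cts_fun. Qed.

Let scale_cts (a : R) (f : contR) : continuous (a \*: f : R -> R).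
Proof. by move=> x; apply: cvgM; [exact: cvg_cst|exact: cts_fun]. Qed.

Let zero_cts : continuous (cst 0 : R -> R).
Proof. by move=> x; exact: cvg_cst. Qed.

Definition contR_zero : contR := toC zero_cts.
Definition contR_add (f g : contR) : contR := toC (@add_cts f g).
Definition contR_opp (f : contR) : contR := toC (@opp_cts f).
Definition contR_scale (a : R) (f : contR) : contR := toC (@scale_cts a f).

Let addA : associative contR_add.
Proof. by move=> f g h; apply/continuousEP => x /=; exact: addrA. Qed.
Let addC : commutative contR_add.
Proof. by move=> f g; apply/continuousEP => x /=; exact: addrC. Qed.
Let add0 : left_id contR_zero contR_add.
Proof. by move=> f; apply/continuousEP => x /=; exact: add0r. Qed.
Let addN : left_inverse contR_zero contR_opp contR_add.
Proof. by move=> f; apply/continuousEP => x /=; exact: addNr. Qed.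

HB.instance Definition _ := GRing.isZmodule.Build contR addA addC add0 addN.

Let scaleA a b f : contR_scale a (contR_scale b f) = contR_scale (a * b) f.
Proof. by apply/continuousEP => x /=; exact: mulrA. Qed.
Let scale1 : left_id 1 contR_scale.
Proof. by move=> f; apply/continuousEP => x /=; exact: mul1r. Qed.
Let scaleDr : right_distributive contR_scale +%R.
Proof. by move=> a f g; apply/continuousEP => x /=; exact: mulrDr. Qed.
Let scaleDl f : {morph contR_scale^~ f : a b / a + b}.
Proof. by move=> a b; apply/continuousEP => x /=; exact: mulrDl. Qed.

HB.instance Definition _ :=
  GRing.Zmodule_isLmodule.Build R contR scaleA scale1 scaleDr scaleDl.

HB.instance Definition _ := Uniform.copy contR
  (initial_topology (id : continuousType R R -> {family compact, R -> R})).

Lemma contRDE (f g : contR) x : (f + g) x = f x + g x.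
Proof. by []. Qed.

Lemma contRZE (a : R) (f : contR) x : (a *: f) x = a * f x.
Proof. by []. Qed.

Lemma contR_nbhsE (f : contR) (U : set contR) :
  nbhs f U <-> exists (A : set R) (e : R), [/\ compact A, 0 < e &
    [set g : contR | forall x, A x -> `|f x - g x| < e] `<=` U].
Proof.
split; last first.
  move=> [A [e [cA e0 AU]]].
  have H : nbhs ((f : R -> R) : {family compact, R -> R})
     [set g | forall x, A x -> `|f x - g x| < e].
    have eE : entourage [set xy : R * R | `|xy.1 - xy.2| < e].
      by rewrite -entourage_ballE; exists e.
    exact: (@fam_nbhs R R compact A _ (f : R -> R) eE cA).
  have := @initial_continuous _ _ (id : continuousType R R -> {family compact, R -> R}) f _ H.
  move=> N; apply: (@filterS _ (nbhs f) _ _ _ AU); exact: N.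
move=> [B []]; case=> O oO OB Bf BU.
pose S (i : set R * R) : set (R -> R) := [set g | forall x, i.1 x -> `|f x - g x| < i.2].
pose D : set (set R * R) := [set i | compact i.1 /\ 0 < i.2].
have FF : Filter (filter_from D S).
  apply: filter_from_filter; first by exists (set0, 1); split=> //=; exact: compact0.
  move=> [A e] [A' e'] [/= cA e0] [/= cA' e'0].
  exists (A `|` A', Num.min e e').
    by split => /=; [exact: compactU|rewrite lt_min e0].
  move=> g /= H; split=> x Ax.
    have /H : (A `|` A') x by left.
    by rewrite lt_min => /andP[].
  have /H : (A `|` A') x by right.
  by rewrite lt_min => /andP[].
have := (@fam_cvgP R R compact (filter_from D S) (f : R -> R) FF).2.
case/(_ _ O) => [A cA V /uniform_nbhs[E [entE EV]]||[A e] [cA e0] AO].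
- move: entE; rewrite -entourage_ballE => -[e /= e0 eE].
  exists (A, e) => // g /= H; apply: EV => y Ay.
  by apply: eE => /=; exact: H.
- by apply: open_nbhs_nbhs; split=> //; rewrite -OB in Bf.
exists A, e; split=> // g Hg; apply: BU; rewrite -OB /=; exact: AO.
Qed.

End ContR.

Section ClosedSubspaces.
Variable R : realType.

Record SF := MkSF {
  SF_set :> set (contR R);
  SF_closed : closed SF_set;
  SF_0 : SF_set 0;
  SF_lin : forall (a : R) u v, SF_set u -> SF_set v -> SF_set (a *: u + v)
}.

(* C(R) itself, as a closed subspace. *)
Definition SFT : SF := @MkSF setT closedT I (fun _ _ _ _ _ => I).

HB.instance Definition _ := gen_eqMixin SF.
HB.instance Definition _ := gen_choiceMixin SF.
HB.instance Definition _ := isPointed.Build SF SFT.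

Definition effros_gen : set (set SF) :=
  [set [set X : SF | (X : set (contR R)) `&` U !=set0] | U in open].

HB.instance Definition _ := Measurable.copy SF (g_sigma_algebraType effros_gen).

End ClosedSubspaces.

(* Linear homeomorphism between the subspaces [X] and [Y]; the maps are
   relevant only on [X] and [Y], with their subspace topologies. *)
Definition lin_isomorphic (R : realType) (V W : preTopologicalLmodType R)
    (X : set V) (Y : set W) : Prop :=
  exists (f : V -> W) (g : W -> V),
    [/\ {homo f : x / X x >-> Y x}, {homo g : y / Y y >-> X y},
        {in X, cancel f g} & {in Y, cancel g f}] /\
    [/\ forall (a : R) u v, X u -> X v -> f (a *: u + v) = a *: f u + f v,
        {within X, continuous f} & {within Y, continuous g}].

Definition iso_class (R : realType) (Y : SF R) : set (SF R) :=
  [set X : SF R | lin_isomorphic (SF_set X) (SF_set Y)].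

Definition is_metric (R : realType) (Z : Type) (dist : Z -> Z -> R) : Prop :=
  [/\ forall x y, 0 <= dist x y,
      forall x y, dist x y = 0 <-> x = y,
      forall x y, dist x y = dist y x &
      forall x y z, dist x z <= dist x y + dist y z].

(* The empty space is Polish; the library's [completeType] would exclude it,
   being pointed. *)
Definition polish_space (R : realType) (Z : topologicalType) : Prop :=
  (exists2 D : set Z, countable D & dense D) /\
  exists dist : Z -> Z -> R,
    [/\ is_metric dist,
        forall (x : Z) (U : set Z), nbhs x U <->
          exists2 e, 0 < e & [set y | dist x y < e] `<=` U &
        forall u : nat -> Z,
          (forall e, 0 < e -> exists N, forall m n,
             (N <= m)%N -> (N <= n)%N -> dist (u m) (u n) < e) ->
          exists l : Z, u @ \oo --> l].

(* Not [measurable_fun]: a [measurableType] is pointed, and the domain may be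
   empty. *)
Definition borel_map (Z : topologicalType) d (S : measurableType d)
    (f : Z -> S) : Prop :=
  forall E : set S, measurable E -> <<s open >> (f @^-1` E).

(* Analytic subsets of a Polish space [Z]. *)
Definition analytic_polish (R : realType) (Z : topologicalType) (B : set Z)
    : Prop :=
  exists (Y : topologicalType) (f : Y -> Z),
    [/\ polish_space R Y, continuous f & range f = B].

(* Analytic subsets of a standard Borel space [S], which has no distinguished
   topology. *)
Definition analytic_borel (R : realType) d (S : measurableType d) (A : set S)
    : Prop :=
  exists (Y : topologicalType) (f : Y -> S),
    [/\ polish_space R Y, borel_map f & range f = A].

(* [R] only serves as the value space of the metrics. *)
Definition complete_analytic (R : realType) d (S : measurableType d)
    (A : set S) : Prop :=
  analytic_borel R A /\
  forall (Z : topologicalType) (B : set Z),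
    polish_space R Z -> analytic_polish R B ->
    exists f : Z -> S, borel_map f /\ f @^-1` A = B.

(* Main.v *)
Require Import Defs.
From HB Require Import structures.
From mathcomp Require Import all_boot all_order all_algebra.
From mathcomp Require Import all_classical all_reals all_analysis.
From mathcomp Require Import ring lra zify.

Set Implicit Arguments.
Unset Strict Implicit.
Unset Printing Implicit Defensive.

Import Order.TTheory GRing.Theory Num.Theory.
Import numFieldNormedType.Exports.
Local Open Scope classical_set_scope.
Local Open Scope ring_scope.

(** The isomorphism class of C(R) is the set of all ranges of linear embeddings
    h : C(R) -> C(R).  Such an h is determined by its values on a dense
    sequence, so it can be coded by a sequence of natural numbers that records,
    for each compact [-n, n], a constant for the upper and lower estimates of h
    there, and approximations, taken from the dense sequence, of the values
    of h on it.  The codes form a closed subset of the Baire space, because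
    embeddings with a common bound converge pointwise to an embedding with the
    same bound; and whether the range of h meets an open set is an open
    condition on the code.  So the class is analytic ([iso_class_analytic]).

    For hardness, an analytic set B in a Polish space Z is first written as
    { z | T z has an infinite branch }, where T z is a tree of finite sequences
    of natural numbers and { z | s is in T z } is open for every s
    ([analytic_tree]).  It remains to attach to a tree T, in a Borel way, a
    closed subspace of C(R) that is isomorphic to C(R) exactly when T has a
    branch ([tree_space_iso_class]).

    The construction takes place in C(N x K), K the Cantor set {0,1}^N, rather
    than in C(R).  A bit sequence is read as a list of lengths of runs of ones,
    and filling up with ones from the first moment at which this list leaves the
    tree is a continuous retraction of K onto a compact subset K_T.
    Composition with it is a projection of C(N x K) onto a copy of C(N x K_T),
    and the latter is transported into C(R) by an extension operator.

    Each branch of T is first doubled into a Cantor set of branches.  If T has a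
    branch, then K_T contains a retract of K homeomorphic to K, so C(N x K_T) and
    C(N x K) are complemented in each other; since C(N x K) is isomorphic to its
    countable power, they are isomorphic by the decomposition method of
    Pelczynski ([Pelczynski]).  In the same way C(R) is isomorphic to C(N x K):
    C(N x K) embeds as a complemented subspace of C(R) by extending functions
    from a closed subset of the line ([extendK]), and C(R) embeds as a
    complemented subspace of C(N x K) by Milutin's lemma ([Milutin_liftK]).
    For the latter a point t is written at random, with probabilities depending
    continuously on t, as the sum of a series with redundant binary digits.

    If T has no branch, then K_T is countable and C(K_T) does not contain l^1: a
    bounded sequence has combinations with coefficients of total absolute value
    1 and arbitrarily small norm.  This is proved along the well-founded tree,
    with a gliding hump argument at each node ([no_l1_cover]).  An isomorphism
    with C(R) is then impossible, since C(R) contains a copy of the sequence of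
    Rademacher functions on K, for which all these norms are at least 1
    ([blk_rademacher], [tree_space_not_iso]). *)

(** * Limits of real sequences, and the topology of C(R) *)

Section RealLimits.
Variable R : realType.

Definition cauchy_mod (u : nat -> R) :=
  forall e, 0 < e -> exists N, forall i j, (N <= i)%N -> (N <= j)%N -> `|u i - u j| <= e.

Lemma cauchy_mod_cvg (u : nat -> R) : cauchy_mod u -> cvgn u.
Proof.
move=> cu; apply/cauchy_cvgP/cauchy_ballP => e e0.
have [N HN] := cu (e / 2) ltac:(by rewrite divr_gt0).
rewrite near_map2; near=> i j; rewrite -ball_normE /=.
apply: (@le_lt_trans _ _ (e / 2)); last by rewrite ltr_pdivrMr // ltr_pMr // ltr1n.
by apply: HN; [near: i|near: j]; exists N.
Unshelve. all: by end_near. Qed.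

(** Non-strict bounds on the distance between terms pass to the limit, so moduli
    of convergence are inherited without loss. *)
Lemma limn_dist (u : nat -> R) (e : R) N : cauchy_mod u ->
  (forall i j, (N <= i)%N -> (N <= j)%N -> `|u i - u j| <= e) ->
  forall i, (N <= i)%N -> `|u i - limn u| <= e.
Proof.
move=> cu H i Ni; have cv := cauchy_mod_cvg cu.
have : `|u i - u j| @[j --> \oo] --> `|u i - limn u|.
  by apply: cvg_norm; apply: cvgB => //; exact: cvg_cst.
move=> /cvg_lim <- //.
apply: limr_le; first by apply: is_cvg_norm; apply: is_cvgB => //; exact: is_cvg_cst.
by near=> j; apply: H => //; near: j; exists N.
Unshelve. all: by end_near. Qed.

Lemma limn_uniq (u : nat -> R) l : (forall e, 0 < e -> exists N, forall i, (N <= i)%N ->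
  `|u i - l| <= e) -> limn u = l.
Proof.
move=> H; apply/cvg_lim => //; apply/cvgrPdist_le => e e0.
by have [N HN] := H e e0; exists N => // i /= Ni; rewrite distrC; exact: HN.
Qed.

Lemma le0_eps (x : R) : (forall e, 0 < e -> `|x| <= e) -> x = 0.
Proof.
move=> H; apply/eqP; case: (eqVneq x 0) => // x0.
have := H (`|x|/2) ltac:(by rewrite divr_gt0 // normr_gt0).
have : 0 < `|x| by rewrite normr_gt0.
lra.
Qed.

Lemma ler_eps (x y : R) : (forall e, 0 < e -> x <= y + e) -> x <= y.
Proof. by move=> H; apply/ler_addgt0Pr => e e0; exact: H. Qed.

Lemma continuousE (f : R -> R) : continuous f <-> forall t e, 0 < e ->
  exists2 d, 0 < d & forall s, `|s - t| < d -> `|f s - f t| <= e.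
Proof.
split=> H t.
  move=> e e0; have /cvgrPdist_le/(_ e e0) := H t.
  move=> [d /= d0 Hd]; exists d => // s st; rewrite distrC; apply: Hd => /=.
  by rewrite distrC.
apply/cvgrPdist_le => e e0; have [d d0 Hd] := H t e e0.
by exists d => //= s /= st; rewrite distrC; apply: Hd; rewrite distrC.
Qed.

Lemma expr_small (c e : R) : 0 < c < 1 -> 0 < e ->
  exists N, forall k, (N <= k)%N -> c ^+ k < e.
Proof.
move=> /andP[c0 c1] e0.
have : c ^+ k @[k --> \oo] --> 0 by apply: cvg_expr; rewrite gtr0_norm.
move/cvgrPdist_lt/(_ e e0) => [N _ HN]; exists N => k Nk.
by have := HN k Nk; rewrite /= sub0r normrN gtr0_norm // exprn_gt0.
Qed.

Definition hpow (k : nat) : R := (1/2) ^+ k.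

Lemma hpow_gt0 k : 0 < hpow k. Proof. by rewrite exprn_gt0. Qed.
Lemma hpowS k : hpow k.+1 = hpow k / 2. Proof. by rewrite /hpow exprS; lra. Qed.
Lemma ler_hpow m n : (hpow m <= hpow n) = (n <= m)%N.
Proof. by rewrite /hpow ler_iXn2l //; lra. Qed.
Lemma ltr_hpow m n : (hpow m < hpow n) = (n < m)%N.
Proof. by rewrite /hpow ltr_iXn2l //; lra. Qed.
Lemma hpow_small e : 0 < e -> exists N, forall k, (N <= k)%N -> hpow k < e.
Proof. by apply: expr_small; lra. Qed.

Lemma mul_div_succ_le (C e : R) : 0 <= C -> 0 < e -> C * (e / (C + 1)) <= e.
Proof.
move=> C0 e0; rewrite mulrCA; apply: ler_piMr; first exact: ltW.
rewrite ler_pdivrMr ?ltr_wpDl //; lra.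
Qed.

End RealLimits.

Section ContRTopology.
Variable R : realType.
Notation CR := (contR R).

(** The bound is a relation rather than a supremum: no seminorm then has to be
    computed, and estimates are transported by monotonicity alone. *)
Definition bndC (n : nat) (c : R) (f : CR) := forall t, `|t| <= n%:R -> `|f t| <= c.

Lemma contRNE (f : CR) t : (- f) t = - f t. Proof. by []. Qed.
Lemma contRBE (f g : CR) t : (f - g) t = f t - g t. Proof. by []. Qed.
Lemma contR0E t : (0 : CR) t = 0. Proof. by []. Qed.

Lemma contR_nbhsP (f : CR) (U : set CR) : nbhs f U <->
  exists (n : nat) (e : R), 0 < e /\ forall g, bndC n e (g - f) -> U g.
Proof.
rewrite contR_nbhsE; split.
  move=> [A [e [/compact_bounded [M [_ /(_ (M + 1)) AM]] e0 H]]].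
  have {}AM : forall t, A t -> `|t| <= M + 1 by apply: AM; rewrite ltrDl.
  exists (Num.truncn (M + 1)).+1, (e / 2); split=> [|g Hg]; first by rewrite divr_gt0.
  apply: H => t At.
  have : `|g t - f t| <= e / 2.
    by apply: Hg; apply: (le_trans (AM t At)); exact/ltW/truncnS_gt.
  by rewrite distrC; lra.
move=> [n [e [e0 H]]]; exists (`[- n%:R, n%:R])%classic, e; split=> //.
  exact: segment_compact.
move=> g Hg; apply: H => t tn; rewrite contRBE distrC; apply/ltW/Hg.
by rewrite /= in_itv /= -ler_norml.
Qed.

Lemma contR_openP (U : set CR) : open U <-> forall f, U f ->
  exists (n : nat) (e : R), 0 < e /\ forall g, bndC n e (g - f) -> U g.
Proof.
rewrite openE; split=> H f Uf; apply/contR_nbhsP; [exact: H|exact: H].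
Qed.

(** A total function into C(R), with the value 0 off the continuous functions,
    so that formulas for operators can be written before their continuity is
    known. *)
Definition contR_of (f : R -> R) : CR :=
  if pselect (continuous f) is left H then mkcts H else 0.

Lemma contR_ofE (f : R -> R) : continuous f -> contR_of f = f :> (R -> R).
Proof. by move=> cf; rewrite /contR_of; case: pselect => // H; case: (H cf). Qed.

Lemma contR_eq (f g : CR) : (forall t, f t = g t) -> f = g.
Proof. by move=> H; exact/continuousEP. Qed.

(** Completeness of C(R), with the limit controlled by the same modulus as the
    sequence. *)
Lemma contR_complete (u : nat -> CR) :
  (forall n e, 0 < e -> exists N, forall i j, (N <= i)%N -> (N <= j)%N ->
     bndC n e (u i - u j)) ->
  exists f, forall n e N, 
    (forall i j, (N <= i)%N -> (N <= j)%N -> bndC n e (u i - u j)) ->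
    forall i, (N <= i)%N -> bndC n e (u i - f).
Proof.
move=> H.
have cu t : cauchy_mod (fun i => u i t).
  move=> e e0; have [N HN] := H (Num.truncn `|t|).+1 e e0.
  by exists N => i j Ni Nj; apply: HN => //; exact/ltW/truncnS_gt.
pose f t := limn (fun i => u i t).
have Hf n e N : 
    (forall i j, (N <= i)%N -> (N <= j)%N -> bndC n e (u i - u j)) ->
    forall i, (N <= i)%N -> forall t, `|t| <= n%:R -> `|u i t - f t| <= e.
  move=> K i Ni t tn; apply: (limn_dist (cu t)) Ni => k l Nk Nl.
  exact: K.
have cf : continuous f.
  apply/continuousE => t e e0.
  have e30 : 0 < e / 3 by rewrite divr_gt0.
  pose n := (Num.truncn (`|t| + 1)).+1.
  have tn : `|t| + 1 <= n%:R by exact/ltW/truncnS_gt.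
  have [N HN] := H n (e / 3) e30.
  have := @Hf n (e/3) N HN N (leqnn N) => K.
  have /continuousE/(_ t (e/3) e30)[d d0 Hd] : continuous (u N) by exact: cts_fun.
  exists (Num.min d 1); first by rewrite lt_min d0 /=.
  move=> s; rewrite lt_min => /andP[sd s1].
  have := Hd s sd; have := K t ltac:(lra).
  have := K s ltac:(have := ler_normD (s - t) t; rewrite subrK; lra).
  rewrite !ler_norml; lra.
exists (contR_of f) => n e N K i Ni t tn.
rewrite contRBE contR_ofE //; exact: (Hf n e N).
Qed.

End ContRTopology.

(** * Spaces with a sequence of seminorms, and their operators *)

Section FSpace.
Variable R : realType.

(** A common frame for C(N x K) and for the closed subspaces of C(R).  The
    domain is a predicate on an ambient module, so that a subspace and the whole
    space share their carrier and operators restrict without coercions;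
    [fbnd n c u] says that the n-th seminorm of u is at most c. *)
Record fspace := FSpace {
  fcar :> lmodType R;
  fdom : set fcar;
  fbnd : nat -> R -> fcar -> Prop;
  fdom0 : fdom 0;
  fdom_lin : forall a u v, fdom u -> fdom v -> fdom (a *: u + v);
  fbnd_ge0 : forall n c u, fbnd n c u -> 0 <= c;
  fbnd_le : forall n c d u, c <= d -> fbnd n c u -> fbnd n d u;
  fbnd_lev : forall m n c u, (m <= n)%N -> fbnd n c u -> fbnd m c u;
  fbnd_lin : forall n c d a u v, fbnd n c u -> fbnd n d v ->
     fbnd n (`|a| * c + d) (a *: u + v) }.

Definition op (A B : fspace) (L : A -> B) := [/\
  forall u, fdom u -> fdom (L u),
  forall a u v, fdom u -> fdom v -> L (a *: u + v) = a *: L u + L v &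
  forall n, exists m C, 0 <= C /\
    forall c u, fdom u -> fbnd m c u -> fbnd n (C * c) (L u)].

Lemma fdomD (A : fspace) (u v : A) : fdom u -> fdom v -> fdom (u + v).
Proof. by move=> du dv; have := fdom_lin 1 du dv; rewrite scale1r. Qed.
Lemma fdomN (A : fspace) (u : A) : fdom u -> fdom (- u).
Proof. by move=> du; have := fdom_lin (-1) du (fdom0 A); rewrite scaleN1r addr0. Qed.
Lemma fdomB (A : fspace) (u v : A) : fdom u -> fdom v -> fdom (u - v).
Proof. by move=> du dv; apply: fdomD => //; exact: fdomN. Qed.
Lemma fdomZ (A : fspace) a (u : A) : fdom u -> fdom (a *: u).
Proof. by move=> du; have := fdom_lin a du (fdom0 A); rewrite addr0. Qed.

Section OpTheory.
Variables A B : fspace.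

Lemma op_dom (L : A -> B) u : op L -> fdom u -> fdom (L u).
Proof. by case=> + _ _; exact. Qed.
Lemma op_lin (L : A -> B) : op L -> forall a u v, fdom u -> fdom v ->
  L (a *: u + v) = a *: L u + L v.
Proof. by case. Qed.
Lemma opD (L : A -> B) u v : op L -> fdom u -> fdom v -> L (u + v) = L u + L v.
Proof. by move=> oL du dv; have := op_lin oL 1 du dv; rewrite !scale1r. Qed.
Lemma op0 (L : A -> B) : op L -> L 0 = 0.
Proof.
move=> oL; have := opD oL (fdom0 A) (fdom0 A); rewrite addr0.
by move/eqP; rewrite -subr_eq0 opprD addrA subrr sub0r oppr_eq0 => /eqP.
Qed.
Lemma opZ (L : A -> B) a u : op L -> fdom u -> L (a *: u) = a *: L u.
Proof. by move=> oL du; have := op_lin oL a du (fdom0 A); rewrite op0 // !addr0. Qed.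
Lemma opN (L : A -> B) u : op L -> fdom u -> L (- u) = - L u.
Proof. by move=> oL du; rewrite -scaleN1r opZ // scaleN1r. Qed.
Lemma opB (L : A -> B) u v : op L -> fdom u -> fdom v -> L (u - v) = L u - L v.
Proof. by move=> oL du dv; rewrite opD ?opN //; exact: fdomN. Qed.

Lemma op_id : op (fun u : A => u).
Proof.
split=> // n; exists n, 1; split=> // c u du; by rewrite mul1r.
Qed.

End OpTheory.

Section OpTheory2.
Variables A B C : fspace.

Lemma op_comp (L : A -> B) (M : B -> C) : op L -> op M -> op (fun u => M (L u)).
Proof.
move=> oL oM; split.
- by move=> u du; apply: op_dom => //; apply: op_dom.
- by move=> a u v du dv; rewrite (op_lin oL) // (op_lin oM) //; exact: op_dom.
move=> n; have [_ _ /(_ n)[m [c [c0 H]]]] := oM.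
have [_ _ /(_ m)[k [d [d0 K]]]] := oL.
exists k, (c * d); split; first exact: mulr_ge0.
move=> e u du bu; rewrite -mulrA; apply: H; first exact: op_dom.
exact: K.
Qed.

Lemma op_addZ (a : R) (L M : A -> B) : op L -> op M -> op (fun u => a *: L u + M u).
Proof.
move=> oL oM; split.
- by move=> u du; apply: fdom_lin; exact: op_dom.
- move=> b u v du dv; rewrite (op_lin oL) // (op_lin oM) // !scalerDr !scalerA.
  by rewrite [a * b]mulrC -!addrA; congr (_ + _); rewrite addrCA.
move=> n; have [_ _ /(_ n)[m [c [c0 H]]]] := oL.
have [_ _ /(_ n)[k [d [d0 K]]]] := oM.
exists (maxn m k), (`|a| * c + d); split; first by rewrite addr_ge0 // mulr_ge0.
move=> e u du bu; rewrite mulrDl -mulrA; apply: fbnd_lin.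
  by apply: H => //; apply: fbnd_lev bu; exact: leq_maxl.
by apply: K => //; apply: fbnd_lev bu; exact: leq_maxr.
Qed.

Lemma op_add (L M : A -> B) : op L -> op M -> op (fun u => L u + M u).
Proof.
move=> oL oM; have := op_addZ 1 oL oM.
by under eq_fun do rewrite scale1r.
Qed.

Lemma op_sub (L M : A -> B) : op L -> op M -> op (fun u => L u - M u).
Proof.
move=> oL oM; have := op_addZ (-1) oM oL.
by under eq_fun do rewrite scaleN1r addrC.
Qed.

End OpTheory2.

Definition iso_ops (A B : fspace) := exists (u : A -> B) (v : B -> A),
  [/\ op u, op v, forall x, fdom x -> v (u x) = x & forall y, fdom y -> u (v y) = y].

Lemma iso_opsC A B : iso_ops A B -> iso_ops B A.
Proof. by move=> [u [v [? ? ? ?]]]; exists v, u; split. Qed.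

Lemma iso_ops_trans A B C : iso_ops A B -> iso_ops B C -> iso_ops A C.
Proof.
move=> [u [v [ou ov vu uv]]] [u' [v' [ou' ov' vu' uv']]].
exists (fun x => u' (u x)), (fun z => v (v' z)); split.
- exact: op_comp.
- exact: op_comp.
- by move=> x dx; rewrite vu' ?vu //; exact: op_dom.
- by move=> x dx; rewrite uv ?uv' //; exact: op_dom.
Qed.

End FSpace.

Section ContRSpace.
Variable R : realType.
Notation CR := (contR R).

Lemma bndC_ge0 n (c : R) (f : CR) : bndC n c f -> 0 <= c.
Proof. by move=> H; apply: (le_trans _ (H 0 _)) => //; rewrite normr0. Qed.

Lemma bndC_le n (c d : R) (f : CR) : c <= d -> bndC n c f -> bndC n d f.
Proof. by move=> cd H t tn; exact: (le_trans (H t tn)). Qed.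

Lemma bndC_lev m n (c : R) (f : CR) : (m <= n)%N -> bndC n c f -> bndC m c f.
Proof. by move=> mn H t tn; apply: H; apply: (le_trans tn); rewrite ler_nat. Qed.

Lemma bndC_lin n (c d a : R) (f g : CR) : bndC n c f -> bndC n d g ->
  bndC n (`|a| * c + d) (a *: f + g).
Proof.
move=> H K t tn; rewrite contRDE contRZE; apply: (le_trans (ler_normD _ _)).
by rewrite normrM lerD ?K // ler_wpM2l // H.
Qed.

Lemma bndCN n (c : R) (f : CR) : bndC n c f -> bndC n c (- f).
Proof. by move=> H t tn; rewrite contRNE normrN; exact: H. Qed.

Lemma bndCD n (c d : R) (f g : CR) : bndC n c f -> bndC n d g -> bndC n (c + d) (f + g).
Proof. by move=> H K; have := bndC_lin 1 H K; rewrite normr1 mul1r scale1r. Qed.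

Lemma bndCZ n (c a : R) (f : CR) : bndC n c f -> bndC n (`|a| * c) (a *: f).
Proof. by move=> H t tn; rewrite contRZE normrM ler_wpM2l // H. Qed.

Definition SFspace (X : SF R) : fspace R :=
  @FSpace R CR X (@bndC R) (SF_0 X) (@SF_lin R X) bndC_ge0 bndC_le bndC_lev bndC_lin.

(** For linear maps, estimates of seminorms and continuity are the same: this
    lemma and its converse below identify the isomorphisms in the sense of
    [iso_ops] with the linear homeomorphisms. *)
Lemma op_continuous (X Y : SF R) (L : CR -> CR) :
  op (A := SFspace X) (B := SFspace Y) L -> {within SF_set X, continuous L}.
Proof.
move=> oL; apply/subspace_continuousP => f Xf U /contR_nbhsP[n [e [e0 H]]].
have [_ _ /(_ n)[m [C [C0 K]]]] := oL.
apply/contR_nbhsP; exists m, (e / (C + 1)); split.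
  by rewrite divr_gt0 // ltr_wpDl.
move=> g Hg Xg /=; apply: H.
have -> : L g - L f = L (g - f) by rewrite (opB oL).
apply: bndC_le (K _ _ _ Hg); last exact: (@fdomB _ (SFspace X)).
exact: mul_div_succ_le.
Qed.

Lemma continuous_op (X Y : SF R) (L : CR -> CR) :
  (forall u, SF_set X u -> SF_set Y (L u)) ->
  (forall a u v, SF_set X u -> SF_set X v -> L (a *: u + v) = a *: L u + L v) ->
  {within SF_set X, continuous L} -> op (A := SFspace X) (B := SFspace Y) L.
Proof.
move=> XY Llin Lc.
have L0 : L 0 = 0.
  have := Llin (-1) _ _ (SF_0 X) (SF_0 X).
  by rewrite scaler0 addr0 scaleN1r addNr.
have LZ a u : SF_set X u -> L (a *: u) = a *: L u.
  by move=> Xu; rewrite -[a *: u]addr0 Llin ?L0 ?addr0 //; exact: SF_0.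
split=> // n.
have N : nbhs (L 0) [set f : CR | bndC n 1 f].
  by apply/contR_nbhsP; exists n, 1; split=> // g; rewrite L0 subr0.
have := (subspace_continuousP _ _).1 Lc 0 (SF_0 X) _ N.
move/contR_nbhsP => [m [e [e0 H]]].
exists m, e^-1; split; first by rewrite invr_ge0 ltW.
move=> c u Xu bu t tn; apply: ler_eps => d d0.
have c0 := bndC_ge0 bu.
have k0 : 0 < c + d * e by rewrite ltr_wpDl // mulr_gt0.
(* scaling by k brings u into the neighbourhood; d * e keeps k finite if c = 0 *)
pose k := e / (c + d * e).
have kp : 0 < k by rewrite divr_gt0.
have : bndC n 1 (L (k *: u)).
  apply: (H (k *: u)); last by have := SF_lin k Xu (SF_0 X); rewrite addr0.
  rewrite subr0; apply: bndC_le (bndCZ k bu).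
  rewrite gtr0_norm // /k mulrAC ler_pdivrMr // ler_pM2l //; nra.
rewrite LZ // => /(_ t tn); rewrite contRZE normrM gtr0_norm // => K.
have : `|L u t| <= k^-1 by rewrite -div1r ler_pdivlMr // mulrC.
by rewrite /k invf_div mulrDl mulfK ?gt_eqF // [e^-1 * c]mulrC.
Qed.

Lemma iso_ops_lin_isomorphic (X Y : SF R) :
  iso_ops (SFspace X) (SFspace Y) <-> lin_isomorphic (SF_set X) (SF_set Y).
Proof.
split.
  move=> [u [v [ou ov vu uv]]]; exists u, v; split; split.
  - by move=> x; case: ou => + _ _; exact.
  - by move=> x; case: ov => + _ _; exact.
  - by move=> x; rewrite inE; exact: vu.
  - by move=> x; rewrite inE; exact: uv.
  - exact: (op_lin ou).
  - exact: op_continuous ou.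
  - exact: op_continuous ov.
move=> [f [g [[fX gY fg gf] [flin fc gc]]]].
exists f, g; split.
- exact: continuous_op.
- apply: continuous_op => // a u v Yu Yv.
  have [Xu Xv] := (gY _ Yu, gY _ Yv).
  rewrite -[RHS]fg; last by rewrite inE; exact: SF_lin.
  by rewrite flin // !gf ?inE.
- by move=> x Xx; apply: fg; rewrite inE.
- by move=> x Xx; apply: gf; rewrite inE.
Qed.

End ContRSpace.

(** * Averaging over addresses of points in an interval *)

Definition bits := nat -> bool.
Definition pref (n : nat) (w : bits) : seq bool := mkseq w n.
Definition consb (b : bool) (w : bits) : bits := fun i => if i is j.+1 then w j else b.
Definition shiftb (w : bits) : bits := fun i => w i.+1.

Lemma prefS n w : pref n.+1 w = w 0%N :: pref n (shiftb w).
Proof.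
by rewrite /pref /mkseq /= (iotaDl 1 0) -map_comp; congr (_ :: _); apply: eq_map.
Qed.

Lemma prefP n w w' : pref n w = pref n w' <-> forall i, (i < n)%N -> w i = w' i.
Proof.
split=> [H i ni|H].
  by have := congr1 (fun s => nth false s i) H; rewrite !nth_mkseq.
by apply: (@eq_from_nth _ false) => [|i]; rewrite !size_mkseq // => ni; rewrite !nth_mkseq // H.
Qed.

Lemma pref_le m n w w' : (m <= n)%N -> pref n w = pref n w' -> pref m w = pref m w'.
Proof. by move=> mn /prefP H; apply/prefP => i im; apply: H; exact: leq_trans im mn. Qed.

Section Uniform.
Variable R : realType.

Lemma uniform_continuity (F : R -> R) (n : nat) (e : R) : continuous F -> 0 < e ->
  exists2 d, 0 < d & forall s s', `|s| <= n%:R -> `|s'| <= n%:R -> `|s - s'| < d ->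
    `|F s - F s'| <= e.
Proof.
move=> cF e0.
have /compact_near_coveringP := @segment_compact R (- n%:R) n%:R.
move=> /(_ R (0^'+) (fun d s => forall s', `|s - s'| < d -> `|F s - F s'| <= e) _) [].
  move=> x _; have /continuousE/(_ x (e/2) ltac:(by rewrite divr_gt0))[d d0 Hd] := cF.
  have d20 : 0 < d / 2 by rewrite divr_gt0.
  exists ([set s | `|x - s| < d / 2], [set k | k < d / 2]) => /=.
    split; first by exists (d/2).
    by exists (d / 2) => //= k /=; rewrite sub0r normrN => K _; exact: (le_lt_trans (ler_norm _)).
  move=> [s k] /= [xs kd] s' ss'.
  have := Hd s ltac:(rewrite distrC; lra).
  have := Hd s' ltac:(move: xs ss' kd; rewrite !ltr_norml; lra).
  rewrite !ler_norml; lra.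
move=> d /= d0 Hd; exists (d / 2); first by rewrite divr_gt0.
move=> s s' sn s'n ss'; apply: (Hd (d / 2)) => //=.
- by rewrite sub0r normrN gtr0_norm ?divr_gt0 // ltr_pdivrMr // ltr_pMr // ltr1n.
- by rewrite divr_gt0.
- by rewrite in_itv /= -ler_norml.
Qed.

(** Continuity on the Cantor set {0,1}^N, which by compactness is uniform. *)
Definition ucont (y : bits -> R) := forall e, 0 < e ->
  exists n, forall w w', pref n w = pref n w' -> `|y w - y w'| <= e.

End Uniform.

Section Averaging.
Variable R : realType.
Variable rho : R.
Hypothesis rho01 : 0 < rho < 1.

(** The maps [theta b] contract [-1, 1] by the factor rho towards its two ends.
    For rho = 2/3 their images overlap and cover [-1, 1]; for rho = 1/3 they are
    disjoint and generate the middle-third Cantor set. *)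
Definition ctr (b : bool) : R := if b then 1 - rho else rho - 1.
Definition theta b s := rho * s + ctr b.
Definition tau b t := (t - ctr b) / rho.

(** The probability that the first digit of t is 0.  It is 1 on the left third
    and 0 on the right third of [-1, 1].  For rho = 2/3, where the images
    overlap exactly in the middle third, a digit of positive probability is
    always a possible one; for rho = 1/3 the digit is forced on both images. *)
Definition weight (t : R) : R := Num.max 0 (Num.min 1 ((1 - 3 * t) / 2)).

Lemma weight01 t : 0 <= weight t <= 1.
Proof. by rewrite /weight le_max lexx /= ge_max ler01 ge_min lexx. Qed.
Lemma weight_lo t : t <= - 3^-1 -> weight t = 1.
Proof.
move=> H; rewrite /weight; have -> : Num.min 1 ((1 - 3 * t) / 2) = 1 by apply/min_l; lra.
by apply/max_r.
Qed.
Lemma weight_hi t : 3^-1 <= t -> weight t = 0.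
Proof. by move=> H; rewrite /weight; apply/max_l; rewrite ge_min; apply/orP; right; lra. Qed.
Lemma continuous_weight : continuous weight.
Proof.
move=> t; pose g : R -> R^o := fun t => (1 - 3 * t) / 2.
have cg : {for t, continuous g}.
  apply: cvgM; last exact: cvg_cst.
  by apply: cvgB; [exact: cvg_cst|apply: cvgM; [exact: cvg_cst|exact: cvg_id]].
have c0 : {for t, continuous (cst 0 : R -> R^o)} by exact: cst_continuous.
have c1 : {for t, continuous (cst 1 : R -> R^o)} by exact: cst_continuous.
exact: (continuous_max c0 (continuous_min c1 cg)).
Qed.

(** The expectation of y at a random address of t of which the first n digits
    are drawn one after the other, the others being 0. *)
Fixpoint average_stage n (y : bits -> R) t := if n is n'.+1 then
  weight t * average_stage n' (fun w => y (consb false w)) (tau false t) +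
  (1 - weight t) * average_stage n' (fun w => y (consb true w)) (tau true t)
  else y (fun=> false).

Lemma convex_dist (p a b c e : R) : 0 <= p <= 1 ->
  (0 < p -> `|a - c| <= e) -> (p < 1 -> `|b - c| <= e) ->
  `|p * a + (1 - p) * b - c| <= e.
Proof.
move=> /andP[p0 p1] Ha Hb.
have [p0'|p0'] := eqVneq p 0; first by rewrite p0' mul0r add0r subr0 mul1r Hb //; lra.
have [p1'|p1'] := eqVneq p 1; first by rewrite p1' subrr mul0r addr0 mul1r Ha //; lra.
have {}p0 : 0 < p by rewrite lt_def p0'.
have {}p1 : p < 1 by rewrite lt_def eq_sym p1'.
move: (Ha p0) (Hb p1); rewrite !ler_norml => /andP[? ?] /andP[? ?]; apply/andP; split; nra.
Qed.

Lemma average_stage_dist n y c e t : (forall w, `|y w - c| <= e) -> `|average_stage n y t - c| <= e.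
Proof.
elim: n y t => [|n IH] y t H /=; first exact: H.
by apply: convex_dist (weight01 t) _ _ => _; exact: IH.
Qed.

Lemma average_stage_lin n a y z t : average_stage n (fun w => a * y w + z w) t = a * average_stage n y t + average_stage n z t.
Proof. by elim: n y z t => [|n IH] y z t //=; rewrite !IH; ring. Qed.

(** A function that is e-constant on the cylinders of length k has stages that
    agree up to 2e from k on: after k digits the value is an average of numbers
    at distance at most e from a common one. *)
Lemma average_stage_close k n m y e t :
  (forall w w', pref k w = pref k w' -> `|y w - y w'| <= e) ->
  (k <= n)%N -> (k <= m)%N -> `|average_stage n y t - average_stage m y t| <= e *+ 2.
Proof.
elim: k n m y t => [|k IH] n m y t H.
  move=> _ _.
  have K j : `|average_stage j y t - y (fun=> false)| <= e by apply: average_stage_dist => w; exact: H.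
  move: (K n) (K m); rewrite mulr2n !ler_norml; lra.
case: n m => [|n] [|m] //; rewrite !ltnS => kn km /=.
set p := weight t; set a := average_stage n _ _; set b := average_stage n _ _.
set a' := average_stage m _ _; set b' := average_stage m _ _.
have -> : p * a + (1 - p) * b - (p * a' + (1 - p) * b') =
   p * (a - a') + (1 - p) * (b - b') - 0 by ring.
by apply: convex_dist (weight01 t) _ _ => _; rewrite subr0; apply: IH => // w w' ww';
   apply: H; rewrite !prefS /=; congr (_ :: _).
Qed.

Lemma continuous_tau b : continuous (tau b).
Proof. by move=> t; apply: cvgM; [apply: cvgB; [exact: cvg_id|exact: cvg_cst]|exact: cvg_cst]. Qed.

Lemma continuous_average_stage n y : continuous (average_stage n y).
Proof.
elim: n y => [|n IH] y t /=; first exact: cvg_cst.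
have K b : {for t, continuous (fun t => average_stage n (fun w => y (consb b w)) (tau b t))}.
  by apply: (@continuous_comp _ _ _ (tau b)); [exact: continuous_tau|exact: IH].
apply: cvgD; apply: cvgM; try exact: K.
  exact: continuous_weight.
by apply: cvgB; [exact: cvg_cst|exact: continuous_weight].
Qed.

Definition average y t := limn (fun n => average_stage n y t).

Lemma average_stage_cauchy y t : ucont y -> cauchy_mod (fun n => average_stage n y t).
Proof.
move=> uy e e0; have [k H] := uy (e/2) ltac:(by rewrite divr_gt0).
exists k => i j ki kj; apply: le_trans (average_stage_close t H ki kj) _; rewrite mulr2n; lra.
Qed.

Lemma average_close k n y e t : ucont y ->
  (forall w w', pref k w = pref k w' -> `|y w - y w'| <= e) ->
  (k <= n)%N -> `|average_stage n y t - average y t| <= e *+ 2.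
Proof.
move=> uy H kn; apply: (limn_dist (average_stage_cauchy t uy)) kn => i j ki kj.
exact: average_stage_close H ki kj.
Qed.

Lemma continuous_average y : ucont y -> continuous (average y).
Proof.
move=> uy; apply/continuousE => t e e0.
have [k H] := uy (e/6) ltac:(by rewrite divr_gt0).
have /continuousE/(_ t (e/3) ltac:(by rewrite divr_gt0))[d d0 Hd] := continuous_average_stage (n:=k) (y:=y).
exists d => // s /Hd.
have := average_close s uy H (leqnn k); have := average_close t uy H (leqnn k).
rewrite !mulr2n !ler_norml; lra.
Qed.

Lemma average_lin a y z t : ucont y -> ucont z ->
  average (fun w => a * y w + z w) t = a * average y t + average z t.
Proof.
move=> uy uz; apply/cvg_lim => //; under eq_fun do rewrite average_stage_lin.
have [cy cz] := (cauchy_mod_cvg (average_stage_cauchy t uy), cauchy_mod_cvg (average_stage_cauchy t uz)).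
by apply: cvgD => //; apply: cvgM => //; exact: cvg_cst.
Qed.

Lemma average_bnd y c t : ucont y -> (forall w, `|y w| <= c) -> `|average y t| <= c.
Proof.
move=> uy H; apply: ler_eps => e e0.
have [k K] := uy (e/2) ltac:(by rewrite divr_gt0).
have := average_close t uy K (leqnn k).
have : `|average_stage k y t - 0| <= c by apply: average_stage_dist => w; rewrite subr0.
rewrite mulr2n subr0 !ler_norml; lra.
Qed.

Fixpoint ifs_stage n (w : bits) : R := if n is n'.+1 then theta (w 0%N) (ifs_stage n' (shiftb w)) else 0.

Lemma theta_itv b s : `|s| <= 1 -> `|theta b s| <= 1.
Proof. by case/andP: rho01 => ? ?; rewrite /theta !ler_norml; case: b => /= /andP[? ?]; apply/andP; split; nra. Qed.

Lemma ifs_stage_itv n w : `|ifs_stage n w| <= 1.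
Proof. by elim: n w => [|n IH] w /=; [rewrite normr0|exact/theta_itv/IH]. Qed.

Lemma ifs_stage_close k n m w w' : pref k w = pref k w' -> (k <= n)%N -> (k <= m)%N ->
  `|ifs_stage n w - ifs_stage m w'| <= 2 * rho ^+ k.
Proof.
elim: k n m w w' => [|k IH] n m w w'.
  move=> _ _ _; rewrite expr0; move: (ifs_stage_itv n w) (ifs_stage_itv m w'); rewrite !ler_norml; lra.
case: n m => [|n] [|m] //; rewrite !prefS !ltnS => -[w0 H] kn km /=; rewrite w0.
have -> : theta (w' 0%N) (ifs_stage n (shiftb w)) - theta (w' 0%N) (ifs_stage m (shiftb w')) =
   rho * (ifs_stage n (shiftb w) - ifs_stage m (shiftb w')) by rewrite /theta; ring.
case/andP: rho01 => r0 r1.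
by rewrite normrM gtr0_norm // exprS mulrCA ler_pM2l // IH.
Qed.

Definition ifs_point (w : bits) : R := limn (fun n => ifs_stage n w).

Lemma rho_small (e : R) : 0 < e -> exists k, 2 * rho ^+ k <= e.
Proof.
move=> e0; have [k /(_ k (leqnn k)) H] := expr_small rho01 (divr_gt0 e0 (ltr0n _ 2)).
by exists k; lra.
Qed.

Lemma ifs_stage_cauchy w : cauchy_mod (fun n => ifs_stage n w).
Proof.
move=> e /rho_small[k H]; exists k => i j ki kj.
exact: le_trans (ifs_stage_close erefl ki kj) H.
Qed.

Lemma ifs_stage_point n w : `|ifs_stage n w - ifs_point w| <= 2 * rho ^+ n.
Proof.
apply: (limn_dist (ifs_stage_cauchy w)) (leqnn n) => i j ni nj; exact: ifs_stage_close.
Qed.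

Lemma ifs_point_itv w : `|ifs_point w| <= 1.
Proof.
apply: ler_eps => e /rho_small[k H].
have := ifs_stage_itv k w; have := ifs_stage_point k w.
rewrite !ler_norml; lra.
Qed.

Lemma ifs_point_close k w w' : pref k w = pref k w' -> `|ifs_point w - ifs_point w'| <= 2 * rho ^+ k.
Proof.
move=> H; apply: ler_eps => e e0.
have [n Hn] := rho_small (divr_gt0 e0 (ltr0n _ 2)).
pose m := maxn n k.
have Hm : 2 * rho ^+ m <= e / 2.
  apply: le_trans Hn; rewrite ler_pM2l // ler_wiXn2l ?leq_maxl //; case/andP: rho01 => *; exact: ltW.
have := ifs_stage_point m w; have := ifs_stage_point m w'.
have := ifs_stage_close H (leq_maxr n k) (leq_maxr n k); rewrite -/m.
rewrite !ler_norml; lra.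
Qed.

Lemma ifs_point_rec w : ifs_point w = theta (w 0%N) (ifs_point (shiftb w)).
Proof.
apply: limn_uniq => e /rho_small[k Hk]; exists k.+1 => -[//|i]; rewrite ltnS => ki /=.
case/andP: rho01 => r0 r1.
have -> : theta (w 0%N) (ifs_stage i (shiftb w)) - theta (w 0%N) (ifs_point (shiftb w)) =
   rho * (ifs_stage i (shiftb w) - ifs_point (shiftb w)) by rewrite /theta; ring.
rewrite normrM gtr0_norm //.
have H1 := ifs_stage_point i (shiftb w).
have H2 : rho ^+ i <= rho ^+ k by rewrite ler_wiXn2l // ltW.
have := normr_ge0 (ifs_stage i (shiftb w) - ifs_point (shiftb w)); nra.
Qed.

Lemma tauK b : cancel (tau b) (theta b).
Proof.
move=> t; rewrite /tau /theta; case/andP: rho01 => r0 _.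
by field; rewrite gt_eqF.
Qed.
Lemma thetaK b : cancel (theta b) (tau b).
Proof. by move=> t; rewrite /tau /theta addrK mulrAC divff ?mul1r //; case/andP: rho01 => r0 _; rewrite gt_eqF. Qed.

Lemma ucont_ifs_point (F : R -> R) : continuous F -> ucont (F \o ifs_point).
Proof.
move=> cF e e0; have [d d0 Hd] := @uniform_continuity R F 1 e cF e0.
have [k Hk] := rho_small (divr_gt0 d0 (ltr0n _ 2)).
exists k => w w' /ifs_point_close H /=; apply: Hd; rewrite ?ifs_point_itv //.
lra.
Qed.

End Averaging.

Section Milutin.
Variable R : realType.
Let rho : R := 2 / 3.
Let rho01 : 0 < rho < 1. Proof. by rewrite /rho; lra. Qed.

(** All addresses drawn with positive probability lead to within 2 rho^n of t,
    so averaging a function of the point alone gives back its value at t. *)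
Lemma Milutin_average_stage n (F : R -> R) e t :
  (forall s s', `|s| <= 1 -> `|s'| <= 1 -> `|s - s'| <= 2 * rho ^+ n -> `|F s - F s'| <= e) ->
  `|t| <= 1 -> `|average_stage rho n (F \o ifs_point rho) t - F t| <= e.
Proof.
elim: n F t => [|n IH] F t H t1 /=.
  apply: H => //; first exact: ifs_point_itv.
  move: (ifs_point_itv rho01 (fun=> false)) t1; rewrite expr0 !ler_norml; lra.
have pE b : (fun w => F (ifs_point rho (consb b w))) = (F \o theta rho b) \o ifs_point rho.
  by apply/funext => w /=; rewrite ifs_point_rec.
(* the overlap of the two images is what keeps tau b t in [-1, 1] *)
have K b : `|tau rho b t| <= 1 ->
    `|average_stage rho n (fun w => F (ifs_point rho (consb b w))) (tau rho b t) - F t| <= e.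
  move=> H1; rewrite pE -{2}(tauK rho01 b t); apply: (IH (F \o theta rho b)) => // s s' s1 s1' ss.
  apply: H; try exact: theta_itv.
  have -> : theta rho b s - theta rho b s' = rho * (s - s') by rewrite /theta; ring.
  by rewrite normrM gtr0_norm ?(andP rho01).1 // exprS mulrCA ler_pM2l // (andP rho01).1.
apply: convex_dist (weight01 t) _ _ => Hw; apply: K.
  have {}Hw : t < 3^-1 by rewrite ltNge; apply/negP => /weight_hi E; rewrite E ltxx in Hw.
  move: t1; rewrite /tau /ctr /rho !ler_norml => /andP[? ?]; apply/andP; split; lra.
have {}Hw : - 3^-1 < t by rewrite ltNge; apply/negP => /weight_lo E; rewrite E ltxx in Hw.
move: t1; rewrite /tau /ctr /rho !ler_norml => /andP[? ?]; apply/andP; split; lra.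
Qed.

Lemma Milutin_average (F : R -> R) t : continuous F -> `|t| <= 1 -> average rho (F \o ifs_point rho) t = F t.
Proof.
move=> cF t1; apply: limn_uniq => e e0.
have [d d0 Hd] := @uniform_continuity R F 1 e cF e0.
have [k Hk] := rho_small rho01 (divr_gt0 d0 (ltr0n _ 2)).
exists k => i ki; apply: Milutin_average_stage => // s s' s1 s1' ss; apply: Hd => //.
apply: le_lt_trans ss _; apply: (@le_lt_trans _ _ (d/2)); last lra.
by apply: le_trans Hk; rewrite ler_pM2l // ler_wiXn2l //; case/andP: rho01 => *; exact: ltW.
Qed.

End Milutin.

Section Extension.
Variable R : realType.
Let rho : R := 1 / 3.
Let rho01 : 0 < rho < 1. Proof. by rewrite /rho; lra. Qed.

(** At a point of the Cantor set every digit is determined, so nothing is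
    averaged: averaging extends functions from the Cantor set to the line. *)
Lemma extension_average_stage n (y : bits -> R) w :
  exists2 w', pref n w' = pref n w & average_stage rho n y (ifs_point rho w) = y w'.
Proof.
elim: n y w => [|n IH] y w /=; first by exists (fun=> false).
have [w' ww' E] := IH (fun v => y (consb (w 0%N) v)) (shiftb w).
exists (consb (w 0%N) w').
  by rewrite !prefS; congr (_ :: _).
rewrite -E (ifs_point_rec rho01 w).
have := ifs_point_itv rho01 (shiftb w); rewrite ler_norml => /andP[? ?].
case: (w 0%N) => /=.
  rewrite weight_hi; first by rewrite mul0r add0r subr0 mul1r thetaK.
  rewrite /theta /ctr /rho; lra.
rewrite weight_lo; first by rewrite subrr mul0r addr0 mul1r thetaK.
rewrite /theta /ctr /rho; lra.
Qed.

Lemma extension_average (y : bits -> R) w : ucont y -> average rho y (ifs_point rho w) = y w.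
Proof.
move=> uy; apply: limn_uniq => e e0; have [k Hk] := uy e e0.
exists k => i ki; have [w' ww' ->] := extension_average_stage i y w.
by apply: Hk; exact: pref_le ki ww'.
Qed.

End Extension.

(** * C(R) and C(N x K) are complemented in each other *)

Section XSpace.
Variable R : realType.

Definition funN := (nat * bits -> R)%type.
Definition ucontN : set funN := [set x | forall k, ucont (fun w => x (k, w))].
Definition bndN n (c : R) (x : funN) := forall k w, (k <= n)%N -> `|x (k, w)| <= c.

Lemma ucont0 : ucont (fun _ : bits => 0 : R).
Proof. by move=> e e0; exists 0%N => *; rewrite subrr normr0 ltW. Qed.

Lemma ucont_lin (a : R) y z : ucont y -> ucont z -> ucont (fun w : bits => a * y w + z w).
Proof.
move=> uy uz e e0.
have a1 : 0 < `|a| + 1 by rewrite ltr_wpDl.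
have [n Hn] := uy (e / 2 / (`|a| + 1)) ltac:(by rewrite !divr_gt0).
have [m Hm] := uz (e / 2) ltac:(by rewrite divr_gt0).
exists (maxn n m) => w w' H.
have {}Hn := Hn w w' (pref_le (leq_maxl _ _) H).
have {}Hm := Hm w w' (pref_le (leq_maxr _ _) H).
rewrite opprD addrACA -mulrBr; apply: (le_trans (ler_normD _ _)).
rewrite normrM (splitr e) lerD //.
move: Hn; rewrite ler_pdivlMr // => Hn; apply: le_trans Hn.
by rewrite mulrC ler_wpM2l // lerDl.
Qed.

Lemma ucontN0 : ucontN 0. Proof. by move=> k; exact: ucont0. Qed.
Lemma ucontN_lin (a : R) u v : ucontN u -> ucontN v -> ucontN (a *: u + v).
Proof. by move=> uu uv k; exact: ucont_lin. Qed.
Lemma bndN_ge0 n c u : bndN n c u -> 0 <= c.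
Proof. by move=> H; exact: (le_trans _ (H 0%N (fun=> false) (leq0n n))). Qed.
Lemma bndN_le n c d u : c <= d -> bndN n c u -> bndN n d u.
Proof. by move=> cd H k w kn; exact: le_trans (H k w kn) cd. Qed.
Lemma bndN_lev m n c u : (m <= n)%N -> bndN n c u -> bndN m c u.
Proof. by move=> mn H k w km; apply: H; exact: leq_trans mn. Qed.
Lemma bndN_lin n c d a u v : bndN n c u -> bndN n d v -> bndN n (`|a| * c + d) (a *: u + v).
Proof.
move=> H K k w kn; apply: (le_trans (ler_normD _ _)).
by rewrite normrM lerD ?K // ler_wpM2l // H.
Qed.

Definition cantorC : fspace R :=
  @FSpace R funN ucontN bndN ucontN0 ucontN_lin bndN_ge0 bndN_le bndN_lev bndN_lin.
Definition lineC : fspace R := SFspace (SFT R).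

(** Averages on the countably many copies of K, rescaled by [sig], are pasted
    together with the locally finite weights [lam]. *)
Section Lift.
Variable rho : R.
Hypothesis rho01 : 0 < rho < 1.
Variables lam sig : nat -> R -> R.
Hypothesis lam_cont : forall m, continuous (lam m).
Hypothesis sig_cont : forall m, continuous (sig m).
Hypothesis lam01 : forall m t, 0 <= lam m t <= 1.
Hypothesis lam0 : forall m t, `|t| + 1 <= m%:R -> lam m t = 0.

Definition average_term (x : funN) t m := lam m t * average rho (fun w => x (m, w)) (sig m t).
(** The weights with index at least |t| + 1 vanish at t, whence the bound of the
    sum. *)
Definition average_sum (x : funN) t := \sum_(0 <= m < (Num.truncn `|t|).+2) average_term x t m.

Lemma average_sum_widen x t (K L : nat) : `|t| + 1 <= K%:R -> (K <= L)%N ->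
  \sum_(0 <= m < K) average_term x t m = \sum_(0 <= m < L) average_term x t m.
Proof.
move=> tK KL; rewrite [RHS](@big_cat_nat _ _ _ K) //= [X in _ = _ + X]big1_seq ?addr0 //.
move=> m /andP[_]; rewrite mem_index_iota => /andP[Km _].
by rewrite /average_term lam0 ?mul0r //; apply: (le_trans tK); rewrite ler_nat.
Qed.

Lemma average_sumE x t (K : nat) : `|t| + 1 <= K%:R ->
  average_sum x t = \sum_(0 <= m < K) average_term x t m.
Proof.
move=> tK; rewrite /average_sum; have /orP[KL|KL] := leq_total K (Num.truncn `|t|).+2.
  by symmetry; exact: average_sum_widen.
apply: average_sum_widen => //.
by rewrite -natr1 lerD2r; exact/ltW/truncnS_gt.
Qed.

Lemma continuous_average_sum x : ucontN x -> continuous (average_sum x).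
Proof.
move=> ux; apply/continuousE => t e e0.
pose K := (Num.truncn (`|t| + 2)).+1.
have tK : `|t| + 2 <= K%:R by exact/ltW/truncnS_gt.
pose g s := \sum_(0 <= m < K) average_term x s m.
have cg : continuous g.
  move=> s; apply: cvg_big => [|m _]; first exact: (@add_continuous R^o).
  apply: cvgM; first exact: lam_cont.
  by apply: (@continuous_comp _ _ _ (sig m)); [exact: sig_cont|exact: continuous_average].
have /continuousE/(_ t e e0)[d d0 Hd] := cg.
exists (Num.min d 1); first by rewrite lt_min d0 /=.
move=> s; rewrite lt_min => /andP[sd s1].
have sK : `|s| + 1 <= K%:R by have := ler_normD (s - t) t; rewrite subrK; lra.
have tK1 : `|t| + 1 <= K%:R by lra.
by rewrite (average_sumE x sK) (average_sumE x tK1); exact: Hd.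
Qed.

Definition average_lift (x : funN) : contR R := contR_of (average_sum x).

Lemma average_liftE x t : ucontN x -> average_lift x t = average_sum x t.
Proof. by move=> ux; rewrite /average_lift contR_ofE //; exact: continuous_average_sum. Qed.

(** On [-n, n] at most n + 1 terms are nonzero, each bounded by the seminorm of x
    on the first n + 1 copies of K. *)
Lemma op_average_lift : op (A := cantorC) (B := lineC) average_lift.
Proof.
split=> //.
  move=> a u v uu uv; apply: contR_eq => t.
  rewrite contRDE contRZE !average_liftE //; last exact: ucontN_lin.
  rewrite /average_sum mulr_sumr -big_split /=; apply: eq_bigr => m _.
  have E := @average_lin R rho a _ _ (sig m t) (uu m) (uv m).
  transitivity (lam m t * (a * average rho (fun w => u (m, w)) (sig m t) +
    average rho (fun w => v (m, w)) (sig m t))); last by rewrite /average_term; ring.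
  by rewrite -E.
move=> n; exists n, n.+1%:R; split=> // c x ux bx t tn.
rewrite average_liftE // (@average_sumE x t n.+1); last by rewrite -natr1 lerD2r.
apply: (le_trans (ler_norm_sum _ _ _)).
rewrite big_mkord.
apply: (@le_trans _ _ (\sum_(m < n.+1) c)); last by rewrite sumr_const card_ord mulr_natl.
apply: ler_sum => m _; rewrite normrM.
have c0 := bndN_ge0 bx.
have /andP[l0 l1] := lam01 m t.
have H : `|average rho (fun w => x (m : nat, w)) (sig m t)| <= c.
  by apply: average_bnd => [|w]; [exact: ux|apply: bx; rewrite -ltnS].
rewrite ger0_norm //; have := normr_ge0 (average rho (fun w => x (m : nat, w)) (sig m t)); nra.
Qed.

Variable q : nat -> R -> R.
Hypothesis q_cont : forall m, continuous (q m).
Hypothesis q_bnd : forall m s, `|s| <= 1 -> `|q m s| <= (4 * m + 1)%:R.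

Definition pullback (f : contR R) : funN := fun z => f (q z.1 (ifs_point rho z.2)).

Lemma op_pullback : op (A := lineC) (B := cantorC) pullback.
Proof.
split=> //.
  move=> f _ k.
  have /(ucont_ifs_point rho01) : continuous (f \o q k).
    by move=> s; apply: (@continuous_comp _ _ _ (q k)); [exact: q_cont|exact: cts_fun].
  exact.
move=> n; exists (4 * n + 1)%N, 1; split=> // c f _ bf k w kn; rewrite mul1r.
apply: bf; apply: (le_trans (q_bnd _ _)); first exact: ifs_point_itv.
by rewrite ler_nat leq_add2r leq_mul2l.
Qed.

End Lift.

Definition hat (t : R) : R := Num.max 0 (Num.min 1 t).

Lemma hat01 t : 0 <= hat t <= 1.
Proof. by rewrite /hat le_max lexx /= ge_max ler01 ge_min lexx. Qed.
Lemma hat_hi t : 1 <= t -> hat t = 1.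
Proof. by move=> H; rewrite /hat (min_l H) (max_r ler01). Qed.
Lemma hat_lo t : t <= 0 -> hat t = 0.
Proof. by move=> H; rewrite /hat; apply/max_l; rewrite ge_min H orbT. Qed.
Lemma hat_id t : 0 <= t <= 1 -> hat t = t.
Proof. by move=> /andP[H K]; rewrite /hat (min_r K) max_r. Qed.
Lemma continuous_hat (g : R -> R) : continuous g -> continuous (fun t => hat (g t)).
Proof.
move=> cg t.
have c0 : {for t, continuous (cst 0 : R -> R^o)} by exact: cst_continuous.
have c1 : {for t, continuous (cst 1 : R -> R^o)} by exact: cst_continuous.
exact: (continuous_max c0 (continuous_min c1 (cg t))).
Qed.
Lemma continuous_absB (a : R) : continuous (fun t : R => `|t - a|).
Proof.
move=> t; apply: (@cvg_norm _ R^o); apply: cvgB; [exact: cvg_id|exact: cvg_cst].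
Qed.

(** The m-th copy of K is mapped onto [-m-1, m+1], and the tent functions of the
    variable |t| centred at the natural numbers are a partition of unity whose
    m-th member vanishes outside that interval. *)
Definition mlam (m : nat) (t : R) := hat (1 - `| (`|t|) - m%:R |).
Definition msig (m : nat) (t : R) := t / m.+1%:R.
Definition mscale (m : nat) (s : R) := m.+1%:R * s.
Definition Milutin_lift := average_lift (2 / 3) mlam msig.
Definition Milutin_pull := pullback (2 / 3) mscale.

Lemma sum_mlam K (s : R) : 0 <= s -> \sum_(0 <= m < K.+1) hat (1 - `|s - m%:R|) = hat (K.+1%:R - s).
Proof.
move=> s0; elim: K => [|K IH]; first by rewrite big_nat1 subr0 ger0_norm.
rewrite big_nat_recr //= IH -(natr1 K.+1) -(natr1 K).
move: K%:R (ler0n R K) => k k0.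
have [H|H] := leP s k.
  rewrite (@hat_hi (k + 1 - s)); last lra.
  rewrite (@hat_hi (k + 1 + 1 - s)); last lra.
  rewrite hat_lo ?addr0 // ler0_norm; lra.
have [H1|H1] := leP s (k + 1).
  rewrite (@hat_hi (k + 1 + 1 - s)); last lra.
  rewrite ler0_norm; last lra.
  by rewrite !hat_id; [ring|lra|lra].
rewrite (@hat_lo (k + 1 - s)); last lra.
rewrite add0r; have [H2|H2] := leP s (k + 1 + 1).
  rewrite ger0_norm; last lra.
  by congr hat; ring.
rewrite ger0_norm; last lra.
by rewrite !hat_lo //; lra.
Qed.

Let r23 : 0 < (2 / 3 : R) < 1. Proof. by lra. Qed.
Let r13 : 0 < (1 / 3 : R) < 1. Proof. by lra. Qed.

Lemma continuous_mlam m : continuous (mlam m).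
Proof.
apply: continuous_hat => t; apply: cvgB; first exact: cvg_cst.
apply: (@cvg_norm _ R^o); apply: cvgB; last exact: cvg_cst.
by apply: (@cvg_norm _ R^o); exact: cvg_id.
Qed.
Lemma continuous_msig m : continuous (msig m).
Proof. by move=> t; apply: cvgM; [exact: cvg_id|exact: cvg_cst]. Qed.
Lemma mlam0 m t : `|t| + 1 <= m%:R -> mlam m t = 0.
Proof. by move=> H; rewrite /mlam hat_lo // ler0_norm; lra. Qed.

Lemma op_Milutin_lift : op (A := cantorC) (B := lineC) Milutin_lift.
Proof.
apply: op_average_lift => //; [exact: continuous_mlam|exact: continuous_msig| |exact: mlam0].
by move=> *; exact: hat01.
Qed.
Lemma op_Milutin_pull : op (A := lineC) (B := cantorC) Milutin_pull.
Proof.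
apply: op_pullback => //.
  by move=> m t; apply: cvgM; [exact: cvg_cst|exact: cvg_id].
move=> m s s1; rewrite /mscale normrM ger0_norm //.
apply: (@le_trans _ _ m.+1%:R); first by rewrite ler_piMr.
by rewrite ler_nat; lia.
Qed.

(** Milutin's lemma for the line: where the m-th weight is nonzero, t is in the
    interval covered by the m-th copy of K and the average is f t; the weights
    have sum 1. *)
Lemma Milutin_liftK f : Milutin_lift (Milutin_pull f) = f.
Proof.
apply: contR_eq => t.
have uf : ucontN (Milutin_pull f) by apply: (op_dom op_Milutin_pull).
rewrite /Milutin_lift average_liftE //; [|exact: continuous_mlam|exact: continuous_msig|exact: mlam0].
pose K := (Num.truncn `|t|).+1.
have tK : `|t| <= K%:R by exact/ltW/truncnS_gt.
rewrite (@average_sumE _ _ _ mlam0 _ _ K.+1); last by rewrite -natr1 lerD2r.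
rewrite (eq_bigr (fun m : nat => mlam m t * f t)).
  rewrite -mulr_suml sum_mlam // hat_hi ?mul1r // -natr1; move: tK; lra.
move=> m _; rewrite /average_term.
have [H|H] := leP (`|t| + 1) m%:R; first by rewrite mlam0 // !mul0r.
have m0 : (0 : R) < m.+1%:R by [].
have [H1|H1] := leP (m%:R + 1) `|t|.
  rewrite (_ : mlam m t = 0) ?mul0r // /mlam hat_lo // ger0_norm; lra.
congr (_ * _).
have -> : (fun w => Milutin_pull f (m, w)) = (f \o mscale m) \o ifs_point (2/3) by [].
rewrite Milutin_average.
- by rewrite /= /mscale /msig mulrC divfK // gt_eqF.
- move=> s; apply: (@continuous_comp _ _ _ (mscale m)); last exact: cts_fun.
  by apply: cvgM; [exact: cvg_cst|exact: cvg_id].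
- rewrite /msig normrM normfV (gtr0_norm m0) ler_pdivrMr // mul1r -natr1; exact: ltW.
Qed.

(** The m-th copy of K is placed around 4m; the weight is 1 on [4m-1, 4m+1] and
    vanishes near the other copies. *)
Definition elam (m : nat) (t : R) := hat (2 - `|t - (4 * m)%:R|).
Definition esig (m : nat) (t : R) := t - (4 * m)%:R.
Definition eshift (m : nat) (s : R) := (4 * m)%:R + s.
Definition extend := average_lift (1 / 3) elam esig.
Definition pull := pullback (1 / 3) eshift.

Lemma continuous_elam m : continuous (elam m).
Proof.
by apply: continuous_hat => t; apply: cvgB; [exact: cvg_cst|exact: continuous_absB].
Qed.
Lemma continuous_esig m : continuous (esig m).
Proof. by move=> t; apply: cvgB; [exact: cvg_id|exact: cvg_cst]. Qed.
Lemma elam0 m t : `|t| + 1 <= m%:R -> elam m t = 0.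
Proof.
move=> H; rewrite /elam hat_lo // natrM.
have := ler_norm t; have := normr_ge0 t => ? ?.
rewrite ler0_norm; lra.
Qed.

Lemma op_extend : op (A := cantorC) (B := lineC) extend.
Proof.
apply: op_average_lift => //; [exact: continuous_elam|exact: continuous_esig| |exact: elam0].
by move=> *; exact: hat01.
Qed.
Lemma op_pull : op (A := lineC) (B := cantorC) pull.
Proof.
apply: op_pullback => //.
  by move=> m t; apply: cvgD; [exact: cvg_cst|exact: cvg_id].
move=> m s s1; rewrite /eshift natrD; apply: (le_trans (ler_normD _ _)).
by rewrite ger0_norm // lerD2l.
Qed.

Lemma extendK x : ucontN x -> pull (extend x) = x.
Proof.
move=> ux; apply/funext => -[m w].
rewrite /pull /pullback /= /extend average_liftE //; [|exact: continuous_elam|exact: continuous_esig|exact: elam0].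
set s := ifs_point _ w.
have s1 : `|s| <= 1 by exact: ifs_point_itv.
rewrite (@average_sumE _ _ _ elam0 _ _ (4 * m + 2)); last first.
  rewrite /eshift natrD; apply: (@le_trans _ _ ((4 * m)%:R + 1 + 1)); last by rewrite -addrA.
  by rewrite lerD2r; apply: (le_trans (ler_normD _ _)); rewrite ger0_norm // lerD2l.
have mK : (m < 4 * m + 2)%N by lia.
rewrite big_mkord (bigD1 (Ordinal mK)) //= big1 ?addr0.
  have E : (4 * m)%:R + s - (4 * m)%:R = s by rewrite addrC addKr.
  rewrite /average_term /elam /esig /eshift E hat_hi; last lra.
  by rewrite mul1r extension_average //; exact: ux.
move=> j /eqP jm; rewrite /average_term /elam hat_lo ?mul0r //.
have {}jm : (j : nat) != m by apply/eqP => E; apply: jm; exact/val_inj.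
rewrite /eshift !natrM; move: s1; rewrite ler_norml => /andP[? ?].
have [jm'|jm'|//] := ltngtP (j : nat) m; last by move=> E; rewrite E eqxx in jm.
  have : (j.+1%:R : R) <= m%:R by rewrite ler_nat.
  rewrite -natr1 => ?; rewrite ger0_norm; lra.
have : (m.+1%:R : R) <= j%:R by rewrite ler_nat.
rewrite -natr1 => ?; rewrite ler0_norm; lra.
Qed.

End XSpace.

(** * The decomposition method *)

Lemma nat_pairing : exists (code : nat * nat -> nat) (unc : nat -> nat * nat),
  cancel code unc /\ cancel unc code.
Proof.
have /card_set_bijP[f bf] := card_nat2.
have fs n : exists p, f p = n.
  by have [p _ fp] := set_bij_surj bf (I : [set: nat] n); exists p.
have [g gf] := choice fs.
exists f, g; split=> [p|//].
by apply: (set_bij_inj bf); rewrite ?inE // gf.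
Qed.

Section Pelczynski.
Variable R : realType.
Notation cantorC := (cantorC R).
Variables (code : nat * nat -> nat) (unc : nat -> nat * nat).
Hypothesis codeK : cancel code unc.
Hypothesis uncK : cancel unc code.

(** The pairing of N x N with N turns C(N x K) into its own countable power, with
    coordinates [slice k] and inverse [glue]. *)
Definition slice (k : nat) (x : cantorC) : cantorC := fun z => x (code (k, z.1), z.2).
Definition glue (y : nat -> cantorC) : cantorC := fun z => y (unc z.1).1 ((unc z.1).2, z.2).

Lemma slice_glue y k : slice k (glue y) = y k.
Proof. by apply/funext => -[l w]; rewrite /slice /glue /= codeK. Qed.

Lemma glue_slice x : glue (slice^~ x) = x.
Proof.
by apply/funext => -[m w]; rewrite /slice /glue /= -surjective_pairing uncK.
Qed.

Lemma nat_bound (f : nat -> nat) n : exists M, forall k, (k <= n)%N -> (f k <= M)%N.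
Proof.
exists (\max_(k < n.+1) f k)%N => k kn.
by rewrite -ltnS in kn; exact: (leq_bigmax (Ordinal kn)).
Qed.

Lemma real_bound (f : nat -> R) n : exists2 M, 0 <= M & forall k, (k <= n)%N -> f k <= M.
Proof.
exists (\sum_(k < n.+1) `|f k|); first by apply: sumr_ge0 => j _; exact: normr_ge0.
move=> k kn; rewrite -ltnS in kn; rewrite (bigD1 (Ordinal kn)) //=.
by apply: ler_wpDr; [apply: sumr_ge0 => j _; exact: normr_ge0|exact: ler_norm].
Qed.

Lemma op_slice k : op (slice k).
Proof.
split=> //; first by move=> u uu l; exact: (uu (code (k, l))).
move=> n; have [M HM] := nat_bound (fun l => code (k, l)) n.
exists M, 1; split=> // c u uu bu l w ln; rewrite mul1r; apply: bu; exact: HM.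
Qed.

Lemma op_glue (A : fspace R) (L : nat -> A -> cantorC) : (forall k, op (L k)) ->
  op (fun f => glue (fun k => L k f) : cantorC).
Proof.
move=> oL; split.
- move=> u du k; exact: ((op_dom (oL (unc k).1) du : ucontN _) (unc k).2).
- by move=> a u v du dv; apply/funext => z; rewrite /glue (op_lin (oL _)).
move=> n; have [K HK] := nat_bound (fun m => (unc m).1) n.
have [N HN] := nat_bound (fun m => (unc m).2) n.
have H k : exists mC : nat * R, 0 <= mC.2 /\
    forall c u, fdom u -> fbnd mC.1 c u -> fbnd N (mC.2 * c) (L k u).
  by have [_ _ /(_ N)[m [C HC]]] := oL k; exists (m, C).
have [mC HmC] := choice H.
have [m Hm] := nat_bound (fun k => (mC k).1) K.
have [C C0 HC] := real_bound (fun k => (mC k).2) K.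
exists m, C; split=> // c u du bu l w ln.
have [_ B] := HmC (unc l).1.
have {}B := B c u du (fbnd_lev (Hm _ (HK _ ln)) bu).
have c0 : 0 <= c by exact: fbnd_ge0 bu.
apply: le_trans (B _ w (HN _ ln)) _.
by apply: ler_wpM2r => //; exact/HC/HK.
Qed.

Variables (A : fspace R) (i : A -> cantorC) (r : cantorC -> A) (a : cantorC -> A) (b : A -> cantorC).
Hypotheses (oi : op i) (or : op r) (oa : op a) (ob : op b).
Hypothesis ri : forall f, fdom f -> r (i f) = f.
Hypothesis ba : forall x, fdom x -> b (a x) = x.

(** A is the direct sum of a copy a(b(A)) of X = C(N x K) and of the range g(A),
    and G is a projection of X onto a copy of g(A).  In X = X^N the slices
    (x_0, x_1, ...) split as G x_k + (x_k - G x_k).  The isomorphism u leaves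
    the parts x_k - G x_k of the copy of X in place, shifts the parts G x_k one
    step to the right, and puts g(A) in the free place 0; v undoes this. *)
Let g (f : A) := f - a (b f).
Let og : op g. Proof. by apply: op_sub; [exact: op_id|exact: op_comp]. Qed.
Let G (x : cantorC) := i (g (r x)).
Let oG : op G. Proof. by apply: (op_comp _ oi); exact: op_comp. Qed.

Let gg f : fdom f -> g (g f) = g f.
Proof.
move=> df; have db := op_dom ob df; have da := op_dom oa db.
have E : b (g f) = 0 by rewrite /g (opB ob) // ba // subrr.
by rewrite {1}/g E (op0 oa) subr0.
Qed.
Let ga x : fdom x -> g (a x) = 0.
Proof. by move=> dx; rewrite /g ba // subrr. Qed.
Let bg f : fdom f -> b (g f) = 0.
Proof.
move=> df; have db := op_dom ob df; have da := op_dom oa db.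
by rewrite /g (opB ob) // ba // subrr.
Qed.
Let GG x : fdom x -> G (G x) = G x.
Proof.
move=> dx; have dr := op_dom or dx; have dg := op_dom og dr.
by rewrite /G ri // gg.
Qed.
Let Gig f : fdom f -> G (i (g f)) = i (g f).
Proof. by move=> df; rewrite /G ri ?gg //; exact: op_dom. Qed.

Let uk k (f : A) : cantorC := slice k (b f) - G (slice k (b f)) +
  (if k is k'.+1 then G (slice k' (b f)) else i (g f)).
Let ouk k : op (uk k).
Proof.
have osb j : op (fun f => slice j (b f)) by apply: (op_comp ob); exact: op_slice.
apply: op_add; first by apply: op_sub => //; exact: (op_comp (osb k) oG).
case: k => [|k]; first exact: (op_comp og oi).
exact: (op_comp (osb k) oG).
Qed.
Let vk k (x : cantorC) : cantorC := slice k x - G (slice k x) + G (slice k.+1 x).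
Let ovk k : op (vk k).
Proof.
apply: op_add; first by apply: op_sub; [exact: op_slice|exact: (op_comp (op_slice k) oG)].
exact: (op_comp (op_slice k.+1) oG).
Qed.
Let u (f : A) : cantorC := glue (fun k => uk k f).
Let v (x : cantorC) : A := g (r (slice 0 x)) + a (glue (fun k => vk k x)).

Lemma Pelczynski_pairing : iso_ops A cantorC.
Proof.
have ov' : op (fun x : cantorC => glue (fun k => vk k x) : cantorC) by exact: op_glue.
exists u, v; split.
- exact: op_glue.
- apply: op_add; last exact: op_comp.
  by apply: (op_comp _ og); apply: (op_comp _ or); exact: op_slice.
- move=> f df.
  have dw k : fdom (slice k (b f)) by apply: (op_dom (op_slice k)); exact: (op_dom ob).
  have dgw k : fdom (G (slice k (b f))) by apply: (op_dom oG).
  have dgf : fdom (g f) by exact: (op_dom og).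
  have dif : fdom (i (g f)) by exact: (op_dom oi).
  have Gu k : G (uk k f) = if k is k'.+1 then G (slice k' (b f)) else i (g f).
    rewrite /uk (opD oG) ?(opB oG) ?GG ?subrr ?add0r //; last by case: k.
      by case: k => [|k]; rewrite ?GG ?Gig.
    exact: fdomB.
  have E : g (r (slice 0 (u f))) = g f.
    rewrite /u slice_glue.
    have := congr1 r (Gu 0%N); rewrite /G !ri //; apply: (op_dom og).
    by apply: (op_dom or); exact: (op_dom (ouk 0)).
  rewrite /v E.
  have -> : glue (fun k => vk k (u f)) = b f.
    rewrite -[RHS]glue_slice; congr glue; apply/funext => k.
    rewrite /vk /u !slice_glue !Gu /uk.
    by rewrite addrK subrK.
  by rewrite /g subrK.
move=> x dx.
have ds k : fdom (slice k x) by exact: (op_dom (op_slice k)).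
have dG k : fdom (G (slice k x)) by exact: (op_dom oG).
have dr : fdom (r (slice 0 x)) by exact: (op_dom or).
have dgl : fdom (glue (fun k => vk k x) : cantorC) by exact: (op_dom ov').
have bv : b (v x) = glue (fun k => vk k x).
  by rewrite /v (opD ob) ?bg ?add0r ?ba //; [exact: (op_dom og)|exact: (op_dom oa)].
have gv : g (v x) = g (r (slice 0 x)).
  by rewrite /v (opD og) ?gg ?ga ?addr0 //; [exact: (op_dom og)|exact: (op_dom oa)].
have Gv k : G (vk k x) = G (slice k.+1 x).
  rewrite /vk (opD oG) ?(opB oG) ?GG ?subrr ?add0r //.
  exact: fdomB.
rewrite /u -[RHS]glue_slice; congr glue; apply/funext => k.
rewrite /uk bv gv !slice_glue Gv {1}/vk addrK.
case: k => [|k]; first by rewrite -[i _]/(G _) subrK.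
by rewrite slice_glue Gv subrK.
Qed.

End Pelczynski.

(** If A and X = C(N x K) are complemented in each other then they are isomorphic.
    A single infinite power is enough, since X absorbs countably many copies of
    the complement of X in A. *)
Lemma Pelczynski (R : realType) (A : fspace R) (i : A -> cantorC R) (r : cantorC R -> A)
    (a : cantorC R -> A) (b : A -> cantorC R) : op i -> op r -> op a -> op b ->
  (forall f, fdom f -> r (i f) = f) -> (forall x, fdom x -> b (a x) = x) ->
  iso_ops A (cantorC R).
Proof.
have [code [unc [codeK uncK]]] := nat_pairing.
by move=> oi or oa ob ri ba; apply: (Pelczynski_pairing codeK uncK oi or oa ob ri ba).
Qed.

Lemma lineC_iso_cantorC (R : realType) : iso_ops (lineC R) (cantorC R).
Proof.
apply: (Pelczynski (op_Milutin_pull R) (op_Milutin_lift R) (op_extend R) (op_pull R)).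
  by move=> f _; exact: Milutin_liftK.
exact: extendK.
Qed.

(** * The closed subspace of C(R) attached to a tree *)

Section Subspaces.
Variable R : realType.
Notation lineC := (lineC R).

(** The next two lemmas hold because the subspaces of C(R) share its carrier and
    its seminorms. *)
Lemma op_sub_dom (X : SF R) (B : fspace R) (L : contR R -> B) :
  op (A := lineC) L -> op (A := SFspace X) L.
Proof.
move=> [LB Llin Lb]; split.
- by move=> u _; exact: LB.
- by move=> a u v _ _; exact: Llin.
- by move=> n; have [m [C [C0 H]]] := Lb n; exists m, C; split=> // c u _; exact: H.
Qed.

Lemma op_sub_codom (X : SF R) (A : fspace R) (L : A -> contR R) :
  op (B := lineC) L -> (forall u, fdom u -> SF_set X (L u)) -> op (B := SFspace X) L.
Proof. by move=> [LB Llin Lb] LX; split. Qed.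

Lemma op_fix_closed (Q : contR R -> contR R) : op (A := lineC) (B := lineC) Q ->
  closed [set f | Q f = f].
Proof.
move=> oQ f clf; apply: contR_eq => t; apply/eqP; rewrite -subr_eq0; apply/eqP/le0_eps => e e0.
pose n := (Num.truncn `|t|).+1.
have [_ _ /(_ n)[m [C [C0 H]]]] := oQ.
have C1 : 0 < C + 1 by rewrite ltr_wpDl.
pose d := e / (C + 1).
have d0 : 0 < d by rewrite divr_gt0.
have N : nbhs f [set g | bndC (maxn m n) d (g - f)].
  by apply/contR_nbhsP; exists (maxn m n), d.
have [g [/= Qg gf]] := clf _ N.
have {}gf := bndCN gf; rewrite opprB in gf.
have B1 : bndC n (C * d) (Q f - g).
  rewrite -[in Q f - g]Qg -(opB oQ) //; apply: H => //.
  exact: bndC_lev (leq_maxl _ _) gf.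
have B2 : bndC n d (f - g) by exact: bndC_lev (leq_maxr _ _) gf.
have tn : `|t| <= n%:R by exact/ltW/truncnS_gt.
have -> : Q f t - f t = (Q f - g) t - (f - g) t by rewrite !contRBE; ring.
apply: (le_trans (ler_normB _ _)); apply: (le_trans (lerD (B1 t tn) (B2 t tn))).
have -> : C * d + d = d * (C + 1) by ring.
by rewrite /d divfK // gt_eqF.
Qed.

Lemma op_fix_lin (Q : contR R -> contR R) : op (A := lineC) (B := lineC) Q ->
  forall (a : R) u v, Q u = u -> Q v = v -> Q (a *: u + v) = a *: u + v.
Proof. by move=> oQ a u v Qu Qv; rewrite (op_lin oQ) // Qu Qv. Qed.

Definition fixSF (Q : contR R -> contR R) (oQ : op (A := lineC) (B := lineC) Q) : SF R :=
  @MkSF R [set f | Q f = f] (op_fix_closed oQ) (op0 oQ) (op_fix_lin oQ).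

Definition ucont_map (h : bits -> bits) := forall n, exists m, forall w w',
  pref m w = pref m w' -> pref n (h w) = pref n (h w').

Definition compose_bits (h : bits -> bits) (x : funN R) : funN R := fun z => x (z.1, h z.2).

Lemma op_compose_bits h : ucont_map h -> op (A := cantorC R) (B := cantorC R) (compose_bits h).
Proof.
move=> uh; split=> //.
  move=> x ux k e e0; have [n Hn] := ux k e e0; have [m Hm] := uh n.
  by exists m => w w' /Hm; exact: Hn.
by move=> n; exists n, 1; split=> // c x ux bx k w kn; rewrite mul1r; exact: bx.
Qed.

End Subspaces.

Section Runs.

Definition rstep (st : nat * seq nat) (b : bool) :=
  if b then (st.1.+1, st.2) else (0%N, st.1 :: st.2).
(** The length of the current run of ones and the list, last one first, of the
    lengths of the runs that a zero has ended. *)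
Definition rstate (w : seq bool) := foldl rstep (0%N, [::]) w.
Definition runs (w : seq bool) := (rstate w).2.

Lemma foldl_rstep st w : exists l, (foldl rstep st w).2 = l ++ st.2.
Proof.
elim: w st => [|b w IH] st /=; first by exists [::].
have [l ->] := IH (rstep st b); case: b => /=; first by exists l.
by exists (rcons l st.1); rewrite cat_rcons.
Qed.

Lemma runs_cat u v : exists l, runs (u ++ v) = l ++ runs u.
Proof. by rewrite /runs /rstate foldl_cat; exact: foldl_rstep. Qed.

Lemma rstate_run_code s l n : rstate s = (0%N, l) ->
  rstate (s ++ rcons (nseq n true) false) = (0%N, n :: l).
Proof.
rewrite /rstate foldl_cat foldl_rcons => ->.
have -> : foldl rstep (0%N, l) (nseq n true) = (n, l) => //.
rewrite -{2}[n]add0n; move: 0%N; elim: n => [|n IH] k /=; first by rewrite addn0.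
by rewrite IH addSnnS.
Qed.

End Runs.

Lemma take_pref m n w : (m <= n)%N -> take m (pref n w) = pref m w.
Proof. by move=> mn; rewrite /pref /mkseq -map_take take_iota (minn_idPl mn). Qed.

(** A tree is a set of finite sequences, written with the last entry first, so
    that it is closed under removing the head. *)
Section Retraction.
Variable T : set (seq nat).
Hypothesis T0 : T [::].
Hypothesis Tcl : forall n s, T (n :: s) -> T s.

Lemma T_suffix l s : T (l ++ s) -> T s.
Proof. by elim: l => //= n l IH /Tcl. Qed.

(** The retraction of K onto K_T: the zero that would complete a run leading out
    of the tree is replaced by a one, and so is everything after it.  The last
    run then never ends, so that the result lies in K_T; digits depend only on
    earlier digits, hence continuity. *)
Definition prune (w : bits) : bits := fun i =>
  if `[< T (runs (pref i.+1 w)) >] then w i else true.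

Lemma prefSr n w : pref n.+1 w = rcons (pref n w) (w n).
Proof. by rewrite /pref mkseqS. Qed.

Lemma prune_inv w i : T (runs (pref i (prune w))) /\
  (T (runs (pref i w)) -> pref i (prune w) = pref i w).
Proof.
elim: i => [//|i [IH1 IH2]].
rewrite [pref i.+1 (prune w)]prefSr {2 4}/prune.
case: asboolP => H.
  have E : pref i (prune w) = pref i w.
    apply: IH2; move: H; rewrite prefSr -cats1.
    by have [l ->] := runs_cat (pref i w) [:: w i]; exact: T_suffix.
  by rewrite E -prefSr; split.
by split=> // ; rewrite /runs /rstate foldl_rcons.
Qed.

Lemma prune_idem w : prune (prune w) = prune w.
Proof.
by apply/funext => i; rewrite {1}/prune asboolT //; have [] := prune_inv w i.+1.
Qed.

Lemma prune_lip n w w' : pref n w = pref n w' -> pref n (prune w) = pref n (prune w').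
Proof.
move=> H; apply/prefP => i ni; rewrite /prune (pref_le ni H).
by move/prefP: H => ->.
Qed.

Lemma prune_fix w : (forall i, T (runs (pref i w))) -> prune w = w.
Proof. by move=> H; apply/funext => i; rewrite /prune asboolT. Qed.

(** Once the run lengths have left the tree, the rest of w is erased. *)
Lemma prune_const u w w' : ~ T (runs (pref u w)) -> pref u w = pref u w' -> prune w = prune w'.
Proof.
move=> H E; apply/funext => i.
have [ui|iu] := leqP u i.+1; last first.
  by have /prefP/(_ i (ltnSn i)) := prune_lip (pref_le (ltnW iu) E).
have K v : ~ T (runs (pref u v)) -> prune v i = true.
  move=> Hv; rewrite /prune asboolF // => Ti; apply: Hv.
  have e : pref u v = take u (pref i.+1 v) by rewrite take_pref.
  have [l] := runs_cat (take u (pref i.+1 v)) (drop u (pref i.+1 v)).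
  by rewrite cat_take_drop -e => E'; rewrite E' in Ti; exact: T_suffix Ti.
by rewrite !K // -E.
Qed.

End Retraction.

(** A branch x gives an embedding of K into K_T, where T contains all the
    branches (2 x_j + u_j) for u in K: the j-th run has length 2 x_j + u_j. *)
Section Branch.
Variable x : nat -> nat.

Definition branch_run (u : bits) (j : nat) := ((x j).*2 + u j)%N.
Fixpoint branch_code (u : bits) (k : nat) : seq bool := if k is k'.+1 then
  branch_code u k' ++ rcons (nseq (branch_run u k') true) false else [::].
Definition branch_point (u : bits) : bits := fun i => nth true (branch_code u i.+1) i.
Fixpoint branch_len (k : nat) : nat := if k is k'.+1 then (branch_len k' + (x k').*2.+2)%N else 0%N.
(** The parity of the k-th run, read off from a prefix whose length is the maximal
    length of the code of u up to the k-th run.  Fixing the length beforehand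
    makes decoding continuous on the whole of K, also at sequences with a run
    that never ends. *)
Definition branch_decode (w : bits) : bits := fun k =>
  odd (nth 0%N (rev (runs (pref (branch_len k.+1) w))) k).

Lemma branch_code_mono u k l : (k <= l)%N -> exists s, branch_code u l = branch_code u k ++ s.
Proof.
elim: l => [|l IH]; first by rewrite leqn0 => /eqP ->; exists [::].
rewrite leq_eqVlt => /orP[/eqP ->|]; first by exists [::]; rewrite cats0.
rewrite ltnS => /IH[s /= ->].
by exists (s ++ rcons (nseq (branch_run u l) true) false); rewrite catA.
Qed.

Lemma size_branch_code u k : (k <= size (branch_code u k))%N.
Proof.
by elim: k => //= k IH; rewrite size_cat size_rcons addnS ltnS; exact: leq_trans IH (leq_addr _ _).
Qed.

Lemma size_branch_code_le u k : (size (branch_code u k) <= branch_len k)%N.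
Proof.
elim: k => //= k IH; rewrite size_cat size_rcons size_nseq leq_add // /branch_run.
by case: (u k); rewrite ?addn1 ?addn0.
Qed.

Lemma branch_code_pref u k i : (i <= size (branch_code u k))%N -> pref i (branch_point u) = take i (branch_code u k).
Proof.
move=> ik; apply: (@eq_from_nth _ true); first by rewrite size_mkseq size_take_min (minn_idPl ik).
rewrite size_mkseq => j ji; rewrite nth_mkseq // nth_take // /branch_point.
have jk := leq_trans ji ik.
have jj : (j < size (branch_code u j.+1))%N by exact: size_branch_code.
have /orP[kj|kj] := leq_total k j.+1.
  by have [s ->] := branch_code_mono u kj; rewrite nth_cat jk.
by have [s ->] := branch_code_mono u kj; rewrite nth_cat jj.
Qed.

Lemma rstate_branch_code u k : rstate (branch_code u k) = (0%N, rev (mkseq (branch_run u) k)).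
Proof.
by elim: k => //= k IH; rewrite (rstate_run_code _ IH) mkseqS rev_rcons.
Qed.

Lemma runs_branch_point (T : set (seq nat)) u : (forall n s, T (n :: s) -> T s) ->
  (forall n, T (rev (mkseq (branch_run u) n))) -> forall i, T (runs (pref i (branch_point u))).
Proof.
move=> Tcl TB i; rewrite (branch_code_pref (size_branch_code u i)).
have [l E] := runs_cat (take i (branch_code u i)) (drop i (branch_code u i)).
move: (TB i); have : runs (branch_code u i) = rev (mkseq (branch_run u) i) by rewrite /runs rstate_branch_code.
by move=> <-; rewrite -{1}[branch_code u i](cat_take_drop i) E; exact: T_suffix.
Qed.

Lemma branch_pointK u : branch_decode (branch_point u) = u.
Proof.
apply/funext => k; rewrite /branch_decode.
have e : pref (size (branch_code u k.+1)) (branch_point u) = branch_code u k.+1.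
  by rewrite (branch_code_pref (leqnn _)) take_size.
have := size_branch_code_le u k.+1; set L := branch_len k.+1 => sL.
have [l] := runs_cat (branch_code u k.+1) (drop (size (branch_code u k.+1)) (pref L (branch_point u))).
rewrite -{1}e -(take_pref _ sL) cat_take_drop => ->.
rewrite /runs rstate_branch_code /= rev_cat revK nth_cat size_mkseq ltnSn nth_mkseq //.
by rewrite /branch_run oddD odd_double; case: (u k).
Qed.

Lemma ucont_branch_point : ucont_map branch_point.
Proof.
move=> n; exists n => w w' /prefP H; apply/prefP => i ni; rewrite /branch_point.
have K k : (k <= n)%N -> branch_code w k = branch_code w' k.
  by elim: k => //= k IH kn; rewrite IH ?(ltnW kn) // /branch_run H.
by rewrite K.
Qed.

Lemma branch_len_mono k l : (k <= l)%N -> (branch_len k <= branch_len l)%N.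
Proof.
elim: l => [|l IH]; first by rewrite leqn0 => /eqP ->.
rewrite leq_eqVlt => /orP[/eqP -> //|]; rewrite ltnS => /IH /leq_trans; apply.
exact: leq_addr.
Qed.

Lemma ucont_branch_decode : ucont_map branch_decode.
Proof.
move=> n; exists (branch_len n) => w w' H; apply/prefP => i ni; rewrite /branch_decode.
by rewrite (pref_le (branch_len_mono ni) H).
Qed.

End Branch.

Section TreeSpace.
Variable R : realType.
Variable T : set (seq nat).
Hypothesis T0 : T [::].
Hypothesis Tcl : forall n s, T (n :: s) -> T s.
Notation lineC := (lineC R).
Notation cantorC := (cantorC R).

Lemma ucont_prune : ucont_map (prune T).
Proof. by move=> n; exists n => w w'; exact: prune_lip. Qed.

Definition prune_op : cantorC -> cantorC := compose_bits (prune T).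
Lemma op_prune : op prune_op.
Proof. exact: (op_compose_bits R ucont_prune). Qed.
Lemma prune_op_idem x : prune_op (prune_op x) = prune_op x.
Proof. by apply/funext => -[k w]; rewrite /prune_op /compose_bits /= prune_idem. Qed.

(** A projection of C(R) onto a copy of C(N x K_T). *)
Definition tree_proj (f : contR R) : contR R := extend (prune_op (pull f)).
Lemma op_tree_proj : op (A := lineC) (B := lineC) tree_proj.
Proof.
exact: (op_comp (A := lineC) (op_comp (op_pull R) op_prune) (op_extend R)).
Qed.

Definition tree_space : SF R := fixSF op_tree_proj.

Lemma tree_space_prune x : ucontN x -> SF_set tree_space (extend (prune_op x)).
Proof.
move=> ux; rewrite /= /tree_proj extendK ?prune_op_idem //.
exact: (op_dom op_prune).
Qed.

Lemma tree_space_pull f : SF_set tree_space f -> prune_op (pull f) = pull f.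
Proof.
move=> /= E; rewrite -{2}E /tree_proj extendK //; apply: (op_dom op_prune).
by apply: (op_dom (op_pull R)).
Qed.

(** C(N x K) is complemented in the tree space, through the copy of K in K_T
    given by the branch and its decoding. *)
Lemma tree_space_iso_cantorC (x : nat -> nat) : (forall u n, T (rev (mkseq (branch_run x u) n))) ->
  iso_ops (SFspace tree_space) cantorC.
Proof.
move=> TB.
have oc := op_compose_bits R (ucont_branch_point x).
have od := op_compose_bits R (ucont_branch_decode x).
have od' := op_comp od op_prune.
apply: (@Pelczynski R (SFspace tree_space) (@pull R) (fun y => extend (prune_op y))
  (fun y => extend (prune_op (compose_bits (branch_decode x) y))) (fun f => compose_bits (branch_point x) (pull f))).
- by apply: op_sub_dom; exact: op_pull.
- apply: op_sub_codom; first exact: (op_comp op_prune (op_extend R)).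
  exact: tree_space_prune.
- apply: op_sub_codom; first exact: (op_comp od' (op_extend R)).
  by move=> y uy; apply: tree_space_prune; exact: (op_dom od).
- by apply: op_sub_dom; exact: (op_comp (op_pull R) oc).
- by [].
- move=> y uy; rewrite extendK; last exact: (op_dom od').
  apply/funext => -[k u]; rewrite /prune_op /compose_bits /= prune_fix ?branch_pointK //.
  exact: runs_branch_point.
Qed.

Lemma tree_space_iso_lineC (x : nat -> nat) : (forall u n, T (rev (mkseq (branch_run x u) n))) ->
  iso_ops (SFspace tree_space) lineC.
Proof.
move=> /tree_space_iso_cantorC H; apply: iso_ops_trans H _; apply: iso_opsC; exact: lineC_iso_cantorC.
Qed.

End TreeSpace.

(** * Bounded sequences with small normalized combinations *)

Section Blocks.
Variable R : realType.

(** [blk y n m v]: v is a combination of the y_i with n <= i < m whose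
    coefficients have sum of absolute values 1.  Generating these by consecutive
    pairs makes the composition of block sequences an induction, without double
    sums. *)
Inductive blk (V : lmodType R) (y : nat -> V) : nat -> nat -> V -> Prop :=
| blk1 n : blk y n n.+1 (y n)
| blk_add n m k u v (a b : R) : blk y n m u -> blk y m k v -> `|a| + `|b| = 1 ->
    blk y n k (a *: u + b *: v)
| blk_wide n n' m u : (n' <= n)%N -> blk y n m u -> blk y n' m u.

Lemma blk_lt (V : lmodType R) (y : nat -> V) n m v : blk y n m v -> (n < m)%N.
Proof.
elim=> {n m v} [n|n m k u v a b _ nm _ mk _|n n' m u nn _ nm]; first exact: ltnSn.
  exact: ltn_trans mk.
exact: leq_ltn_trans nm.
Qed.

Lemma blk_comp (V : lmodType R) (y z : nat -> V) (N : nat -> nat) :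
  (forall j, blk y (N j) (N j.+1) (z j)) ->
  forall j k v, blk z j k v -> blk y (N j) (N k) v.
Proof.
move=> H j k v; elim=> {j k v} [n|n m k u v a b _ IH1 _ IH2 ab|n n' m u nn _ IH].
- exact: H.
- exact: blk_add IH1 IH2 ab.
- apply: blk_wide IH; elim: n nn => [|n IHn]; first by rewrite leqn0 => /eqP ->.
  rewrite leq_eqVlt => /orP[/eqP ->//|]; rewrite ltnS => /IHn /leq_trans; apply.
  exact/ltnW/(blk_lt (H n)).
Qed.

Lemma blk_shift (V : lmodType R) (y : nat -> V) N n m v :
  blk (fun i => y (N + i)%N) n m v -> blk y (N + n) (N + m) v.
Proof.
elim=> {n m v} [n|n m k u v a b _ IH1 _ IH2 ab|n n' m u nn _ IH].
- by rewrite addnS; exact: blk1.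
- exact: blk_add IH1 IH2 ab.
- by apply: blk_wide IH; rewrite leq_add2l.
Qed.

Lemma blk_scale (V : lmodType R) (y : nat -> V) (c : R) n m v :
  blk (fun i => c *: y i) n m v -> exists v', blk y n m v' /\ v = c *: v'.
Proof.
elim=> {n m v} [n|n m k u v a b _ [u' [bu ->]] _ [v' [bv ->]] ab|n n' m u nn _ [u' [bu ->]]].
- by exists (y n); split=> //; exact: blk1.
- exists (a *: u' + b *: v'); split; first exact: blk_add bu bv ab.
  by rewrite scalerDr !scalerA ![c * _]mulrC.
- by exists u'; split=> //; exact: blk_wide bu.
Qed.

Lemma blk_op (A B : fspace R) (L : A -> B) (y : nat -> A) n m v : op L ->
  (forall i, fdom (y i)) -> blk (fun i => L (y i)) n m v ->
  exists v', [/\ blk y n m v', fdom v' & v = L v'].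
Proof.
move=> oL dy.
elim=> {n m v} [n|n m k u v a b _ [u' [bu du ->]] _ [v' [bv dv ->]] ab|n n' m u nn _ [u' [bu du ->]]].
- by exists (y n); split=> //; exact: blk1.
- exists (a *: u' + b *: v'); split; first exact: blk_add bu bv ab.
    by apply: fdom_lin => //; exact: fdomZ.
  by rewrite (op_lin oL a du (fdomZ b dv)) (opZ b oL dv).
- by exists u'; split=> //; exact: blk_wide bu.
Qed.

End Blocks.

Section NoEllOne.
Variables (R : realType) (Om : Type).
Let V := (Om -> R)%type.
Variable W : set V.
Hypothesis Wlin : forall (a b : R) u v, W u -> W v -> W (a *: u + b *: v).

Definition bnd_on (A : set Om) (c : R) (u : V) := forall z, A z -> `|u z| <= c.

(** Every sequence in the linear class W that is bounded by 1 on A has a normalized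
    combination that is bounded by c there.  If this holds for every c > 0 then
    no sequence in W behaves on A like the basis of l^1. *)
Definition shrinks (c : R) (A : set Om) := forall y : nat -> V, (forall n, W (y n)) ->
  (forall n, bnd_on A 1 (y n)) -> exists n m v, blk y n m v /\ bnd_on A c v.

Definition no_l1 (A : set Om) := forall e, 0 < e -> shrinks e A.

Lemma blk_W y n m v : (forall i, W (y i)) -> blk y n m v -> W v.
Proof. by move=> Wy; elim=> // *; exact: Wlin. Qed.

Lemma blk_bnd_on A c y n m v : (forall i, bnd_on A c (y i)) -> blk y n m v -> bnd_on A c v.
Proof.
move=> By; elim=> // {n m v} n m k u v a b _ IH1 _ IH2 ab z Az.
apply: (le_trans (ler_normD _ _)); rewrite !normrM.
have -> : c = `|a| * c + `|b| * c by rewrite -mulrDl ab mul1r.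
by apply: lerD; apply: ler_wpM2l => //; [exact: IH1|exact: IH2].
Qed.

Lemma shrinks_tail c A : shrinks c A -> forall y, (forall n, W (y n)) ->
  (forall n, bnd_on A 1 (y n)) -> forall N, exists m v, blk y N m v /\ bnd_on A c v.
Proof.
move=> rA y Wy By N.
have [n [m [v [bv Bv]]]] := rA (fun i => y (N + i)%N) (fun i => Wy _) (fun i => By _).
exists (N + m)%N, v; split=> //; apply: blk_wide (blk_shift bv); exact: leq_addr.
Qed.

Lemma shrinks_seq c A : shrinks c A -> forall y, (forall n, W (y n)) ->
  (forall n, bnd_on A 1 (y n)) -> exists (N : nat -> nat) (z : nat -> V),
  forall j, [/\ blk y (N j) (N j.+1) (z j), W (z j) & bnd_on A c (z j)].
Proof.
move=> rA y Wy By.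
have H N : exists mv : nat * V, blk y N mv.1 mv.2 /\ bnd_on A c mv.2.
  by have [m [v ?]] := shrinks_tail rA Wy By N; exists (m, v).
have [F HF] := choice H.
pose N j := iter j (fun n => (F n).1) 0%N.
exists N, (fun j => (F (N j)).2) => j; have [b B] := HF (N j).
by split=> //; exact: blk_W b.
Qed.

Lemma shrinks_le c d A : c <= d -> shrinks c A -> shrinks d A.
Proof.
move=> cd rA y Wy By; have [n [m [v [b B]]]] := rA y Wy By.
by exists n, m, v; split=> // z /B /le_trans; apply.
Qed.

Lemma WZ (a : R) u : W u -> W (a *: u).
Proof. by move=> Wu; have := Wlin a 0 Wu Wu; rewrite scale0r addr0. Qed.

(** Shrinking by c can be done along a sequence of successive blocks, which after
    division by c is again bounded by 1 and can be shrunk by d.  So any fixed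
    factor smaller than 1 suffices ([shrinks_no_l1]). *)
Lemma shrinks_mul c d A : 0 < c -> shrinks c A -> shrinks d A -> shrinks (c * d) A.
Proof.
move=> c0 rc rd y Wy By.
have [N [z Hz]] := shrinks_seq rc Wy By.
have [i||n [m [v [b B]]]] := rd (fun j => c^-1 *: z j).
- by apply: WZ; case: (Hz i).
- move=> i t At; rewrite /= normrM gtr0_norm ?invr_gt0 // mulrC ler_pdivrMr // mul1r.
  by case: (Hz i) => _ _; exact.
have [v' [b' E]] := blk_scale b.
exists (N n), (N m), v'; split; first by apply: blk_comp b' => j; case: (Hz j).
move=> t At; have := B t At; rewrite E /= normrM gtr0_norm ?invr_gt0 //.
by rewrite [c^-1 * _]mulrC ler_pdivrMr // mulrC.
Qed.

Lemma shrinks_no_l1 c A : 0 < c < 1 -> shrinks c A -> no_l1 A.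
Proof.
move=> c01 rc e e0; have c0 := (andP c01).1.
have [k /(_ k (leqnn k)) /ltW H] := expr_small c01 e0; apply: shrinks_le H _.
elim: k => [|k IH]; last by rewrite exprS; exact: shrinks_mul.
move=> y Wy By; exists 0%N, 1%N, (y 0%N); split; first exact: blk1.
exact: By.
Qed.

Lemma no_l1_const A : (forall u, W u -> forall z z', A z -> A z' -> u z = u z') -> no_l1 A.
Proof.
move=> HA; apply: (@shrinks_no_l1 (1/2)); first by lra.
move=> y Wy By.
have [[z0 Az0]|A0] := pselect (A !=set0); last first.
  exists 0%N, 1%N, (y 0%N); split; first exact: blk1.
  by move=> z Az; case: A0; exists z.
have B2 : blk y 1 2 (y 1%N) by exact: blk1.
have K (a b : R) : `|a| + `|b| = 1 -> `|a * y 0%N z0 + b * y 1%N z0| <= 1/2 ->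
    exists n m v, blk y n m v /\ bnd_on A (1 / 2) v.
  move=> ab H; exists 0%N, 2%N, (a *: y 0%N + b *: y 1%N); split.
    exact: blk_add (blk1 y 0) B2 ab.
  move=> z Az; rewrite (HA _ (Wlin a b (Wy 0%N) (Wy 1%N)) z z0 Az Az0); exact: H.
have := By 0%N z0 Az0; have := By 1%N z0 Az0; rewrite !ler_norml => /andP[b1 b2] /andP[a1 a2].
have h : `|(1/2 : R)| = 1/2 by rewrite ger0_norm //; lra.
(* two numbers in [-1, 1] have half-sum or half-difference in [-1/2, 1/2] *)
have [H|H] := leP (`|y 0%N z0 + y 1%N z0|) 1.
  apply: (K (1/2) (1/2)); first by rewrite h; lra.
  move: H; rewrite !ler_norml => /andP[? ?]; apply/andP; split; lra.
apply: (K (1/2) (- (1/2))); first by rewrite normrN h; lra.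
rewrite ler_norml; move: H; rewrite lter_normr => /orP[H|H]; apply/andP; split; lra.
Qed.

(** First make the blocks small on A, then combine those blocks to make them small
    on B; smallness on A survives. *)
Lemma no_l1_union A B : no_l1 A -> no_l1 B -> no_l1 (A `|` B).
Proof.
move=> nA nB e e0 y Wy By.
have [N [z Hz]] := shrinks_seq (nA e e0) Wy (fun n z Az => By n z (or_introl Az)).
have zB j : bnd_on B 1 (z j).
  have [b _ _] := Hz j; apply: blk_bnd_on b => i t Bt; apply: By; by right.
have [n [m [v [b Bv]]]] := nB e e0 z (fun j => let: And3 _ h _ := Hz j in h) zB.
exists (N n), (N m), v; split; first by apply: blk_comp b => j; case: (Hz j).
move=> t [At|Bt]; last exact: Bv.
by apply: (blk_bnd_on _ b) At => j; case: (Hz j).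
Qed.

Lemma no_l1_eq A B : (A `<=` B) -> (B `<=` A) -> no_l1 A -> no_l1 B.
Proof. by move=> AB BA; have -> : B = A by apply/seteqP. Qed.

Lemma no_l1_bigU (A : nat -> set Om) M : (forall m, no_l1 (A m)) ->
  no_l1 [set z | exists2 m, (m < M)%N & A m z].
Proof.
move=> nA; elim: M => [|M IH].
  by apply: no_l1_const => u _ z z' [].
apply: no_l1_eq (no_l1_union IH (nA M)).
  move=> z [[m mM Az]|Az]; first by exists m => //; exact: ltnW.
  by exists M.
move=> z [m]; rewrite ltnS leq_eqVlt => /orP[/eqP ->|mM] Az; [by right|left].
by exists m.
Qed.

(** The pieces P m converge to the point z0, in the sense that on P m the values
    of u are eventually bounded by |u z0| + e.  A block v that is small at z0 is
    small on all pieces but finitely many; a later block w can be made small at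
    z0 and on these.  At each point at least one of v and w is small, so their
    mean is bounded by 3/4. *)
Lemma no_l1_cover A z0 (P : nat -> set Om) : A z0 -> (forall m, P m `<=` A) ->
  A `<=` [set z0] `|` [set z | exists m, P m z] -> (forall m, no_l1 (P m)) ->
  (forall u e, W u -> 0 < e -> exists M, forall m z, (M <= m)%N -> P m z -> `|u z| <= `|u z0| + e) ->
  no_l1 A.
Proof.
move=> Az0 PA AP nP lim; apply: (@shrinks_no_l1 (3/4)); first by lra.
move=> y Wy By.
have n0 : no_l1 [set z0] by apply: no_l1_const => u _ z z' -> ->.
have q0 : 0 < (1/4 : R) by lra.
have y0 n : bnd_on [set z0] 1 (y n) by move=> z ->; exact: By.
have [m [v [bv Bv]]] := shrinks_tail (n0 _ q0) Wy y0 0.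
have [M HM] := lim v _ (blk_W Wy bv) q0.
have nB := no_l1_union n0 (no_l1_bigU (M := M) nP).
have yB n : bnd_on ([set z0] `|` [set z | exists2 m, (m < M)%N & P m z]) 1 (y n).
  move=> z [->|[k _ Pz]]; first exact: By.
  by apply: By; exact: PA Pz.
have [k [w [bw Bw]]] := shrinks_tail (nB _ q0) Wy yB m.
have h : `|(1/2 : R)| = 1/2 by rewrite ger0_norm //; lra.
exists 0%N, k, ((1/2) *: v + (1/2) *: w); split.
  by apply: blk_add bv bw _; rewrite h; lra.
have Av := blk_bnd_on By bv; have Aw := blk_bnd_on By bw.
move=> z Az.
have K a b : `|v z| <= a -> `|w z| <= b -> a + b <= 3/2 ->
    `|((1/2) *: v + (1/2) *: w) z| <= 3/4.
  have -> : ((1/2) *: v + (1/2) *: w) z = (1/2) * v z + (1/2) * w z by [].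
  rewrite !ler_norml => /andP[? ?] /andP[? ?] ?; apply/andP; split; lra.
have [zz0|[j Pz]] := AP z Az.
  by apply: (K (1/4) (1/4)); [exact: Bv|apply: Bw; left|lra].
have [Mj|jM] := leqP M j.
  apply: (K (1/2) 1); [|exact: Aw|lra].
  by have := HM j z Mj Pz; have := Bv z0 erefl; lra.
apply: (K 1 (1/4)); [exact: Av| |lra].
by apply: Bw; right; exists j.
Qed.

End NoEllOne.

(** * Trees without branches *)

Section WellFounded.
Variable R : realType.
Variable T : set (seq nat).
Hypothesis Tcl : forall n s, T (n :: s) -> T s.
Notation lineC := (lineC R).
Notation cantorC := (cantorC R).

Definition pruned : set (nat * bits -> R) := [set x | ucontN x /\ prune_op T x = x].

Lemma pruned_lin (a b : R) u v : pruned u -> pruned v -> pruned (a *: u + b *: v).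
Proof.
move=> [uu pu] [uv pv].
have ubv : @fdom _ cantorC (b *: v) by apply: (@fdomZ _ cantorC).
split; first exact: (@fdom_lin _ cantorC).
by rewrite (op_lin (op_prune R T)) // (opZ b (op_prune R T)) // pu pv.
Qed.

Definition cyl (k : nat) (u : seq bool) : set (nat * bits) :=
  [set z | z.1 = k /\ pref (size u) z.2 = u].

Definition run_code n := rcons (nseq n true) false.

(** A continuation of u begins with a finite run of ones, or consists of ones
    only. *)
Lemma cyl_split u w : pref (size u) w = u ->
  (forall i, (size u <= i)%N -> w i = true) \/
  exists n, pref (size (u ++ run_code n)) w = u ++ run_code n.
Proof.
move=> H.
have [[i [ui wi]]|Hn] := pselect (exists i, (size u <= i)%N /\ w i = false); last first.
  left=> i ui; apply: contrapT => /negP wi; apply: Hn; exists i; split=> //.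
  exact/negbTE.
right.
have ex : exists i, (size u <= i)%N && ~~ w i by exists i; rewrite ui wi.
have := ex_minnP ex => -[m /andP[um wm] mmin].
exists (m - size u)%N.
apply: (@eq_from_nth _ true); first by rewrite size_mkseq.
move=> j; rewrite size_mkseq => jl; rewrite nth_mkseq // nth_cat.
case: ltnP => [ju|uj].
  by rewrite -[in RHS]H nth_mkseq.
move: jl; rewrite size_cat size_rcons size_nseq addnS ltnS subnKC // => jm.
rewrite nth_rcons size_nseq ltn_sub2rE //.
case: ltnP => [jm'|mj].
  rewrite nth_nseq ltn_sub2rE // jm'; apply: contraLR jm'.
  by move=> wj; rewrite -leqNgt; apply: mmin; rewrite uj wj.
have -> : j = m by apply/eqP; rewrite eqn_leq jm mj.
by rewrite eqxx; exact/negbTE.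
Qed.

(** If s is not in T, pruned functions are constant on the cylinder of u.  If s is
    in T, the cylinder consists of the point u followed by ones and of the
    cylinders of the successors of u, which converge to that point. *)
Lemma no_l1_step k u s : rstate u = (0%N, s) -> ~ no_l1 pruned (cyl k u) ->
  T s /\ exists n, ~ no_l1 pruned (cyl k (u ++ run_code n)).
Proof.
move=> us nn; split.
  apply: contrapT => nT; apply: nn; apply: no_l1_const; first exact: pruned_lin.
  move=> x [_ px] [k1 w1] [k2 w2] [/= -> e1] [/= -> e2].
  rewrite -px /prune_op /compose_bits /= (@prune_const T Tcl (size u) w1 w2) //; last by rewrite e1 e2.
  by rewrite e1 /runs us.
apply: contrapT => /forallNP H; apply: nn.
pose w0 : bits := fun i => nth true u i.
have pw0 : pref (size u) w0 = u by rewrite /pref /w0 mkseq_nth.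
apply: (@no_l1_cover R _ pruned pruned_lin (cyl k u) (k, w0) (fun n => cyl k (u ++ run_code n))).
- by [].
- move=> n [k' w] [/= -> e]; split=> //=.
  rewrite -(@take_pref (size u) (size (u ++ run_code n))) ?size_cat ?leq_addr //.
  by rewrite -size_cat e take_size_cat.
- move=> [k' w] [/= -> e]; have [H1|[n Hn]] := cyl_split e; [left|by right; exists n].
  rewrite /=; congr pair; apply/funext => i; rewrite /w0.
  have [iu|ui] := ltnP i (size u); first by rewrite -e nth_mkseq.
  by rewrite nth_default // H1.
- by move=> n; have /contrapT := H n.
move=> x e [ux _] e0; have [N HN] := ux k e e0.
exists N => m [k' w] Nm [/= -> ew].
have : `|x (k, w) - x (k, w0)| <= e.
  apply: HN; apply/prefP => i iN.
  have im : (i < size u + m)%N by exact: (leq_trans iN (leq_trans Nm (leq_addl _ _))).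
  have := congr1 (fun s => nth true s i) ew.
  rewrite nth_mkseq; last by rewrite size_cat size_rcons size_nseq addnS ltnW.
  move=> ->; rewrite nth_cat /w0; case: ltnP => // ui; rewrite (nth_default _ ui).
  have h : (i - size u < m)%N by lia.
  by rewrite nth_rcons size_nseq h nth_nseq h.
have := ler_normD (x (k, w) - x (k, w0)) (x (k, w0)); rewrite subrK; lra.
Qed.

(** Following successors for which the property fails would produce a branch. *)
Lemma no_l1_level k : ~ (exists m : nat -> nat, forall j, T (rev (mkseq m j))) ->
  no_l1 pruned [set z | z.1 = k].
Proof.
move=> nb; apply: contrapT => nn; apply: nb.
have n0 : ~ no_l1 pruned (cyl k [::]).
  by move=> H; apply: nn; apply: no_l1_eq H => [z []//|z]; split.
pose bad u := (rstate u).1 = 0%N /\ ~ no_l1 pruned (cyl k u).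
have H u : exists n, bad u -> bad (u ++ run_code n).
  have [[s0 nu]|] := pselect (bad u); last by exists 0%N.
  have us : rstate u = (0%N, (rstate u).2) by rewrite -{1}s0 -surjective_pairing.
  have [_ [n Hn]] := no_l1_step us nu; exists n => _; split=> //.
  by rewrite (rstate_run_code _ us).
have [f Hf] := choice H.
pose U := fix U j := if j is j'.+1 then U j' ++ run_code (f (U j')) else [::].
have bU j : bad (U j) by elim: j => //= j IH; exact: Hf.
pose m j := f (U j).
have sU j : rstate (U j) = (0%N, rev (mkseq m j)).
  by elim: j => //= j IH; rewrite (rstate_run_code _ IH) mkseqS rev_rcons.
exists m => j; have [_ nj] := bU j.
by have [] := no_l1_step (sU j) nj.
Qed.

Definition rademacher (n : nat) : nat * bits -> R := fun z => if z.2 n then 1 else -1.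

Lemma ucontN_rademacher n : ucontN (rademacher n).
Proof.
move=> k e e0; exists n.+1 => w w' /prefP/(_ n (ltnSn n)) E.
by rewrite /rademacher /= E subrr normr0 ltW.
Qed.

Lemma bndN_rademacher n m : bndN m 1 (rademacher n).
Proof. by move=> k w _; rewrite /rademacher; case: ifP; rewrite ?normrN normr1. Qed.

(** The coordinates are independent, so the bits can be chosen to give all the
    terms of a combination the same sign. *)
Lemma blk_rademacher n m x : blk rademacher n m x -> forall b : bool, exists e : bits,
  forall k w, (forall i, (n <= i < m)%N -> w i = e i) -> x (k, w) = (-1) ^+ b.
Proof.
elim=> {n m x} [n|n m k u v a b bu IH1 bv IH2 ab|n n' m u nn _ IH] s.
- exists (fun=> ~~ s) => k w H; rewrite /rademacher /= H ?leqnn //.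
  by case: s {H}; rewrite /= ?expr1 ?expr0.
- have [e1 H1] := IH1 (s (+) (a < 0)).
  have [e2 H2] := IH2 (s (+) (b < 0)).
  exists (fun i => if (i < m)%N then e1 i else e2 i) => j w H.
  have E1 : u (j, w) = (-1) ^+ (s (+) (a < 0)).
    apply: H1 => i /andP[ni im].
    have nk : (n <= i < k)%N by rewrite ni (ltn_trans im (blk_lt bv)).
    by rewrite (H i nk) im.
  have E2 : v (j, w) = (-1) ^+ (s (+) (b < 0)).
    apply: H2 => i /andP[mi ik].
    have nk : (n <= i < k)%N by rewrite ik andbT (leq_trans (ltnW (blk_lt bu)) mi).
    by rewrite (H i nk) ltnNge mi.
  have S (c : R) : c * (-1) ^+ (s (+) (c < 0)) = (-1) ^+ s * `|c|.
    rewrite signr_addb mulrCA; congr (_ * _).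
    have [h|h] := ltP c 0; first by rewrite expr1 mulrN1 ltr0_norm.
    by rewrite expr0 mulr1 ger0_norm.
  transitivity (a * u (j, w) + b * v (j, w)); first by [].
  by rewrite E1 E2 !S -mulrDr ab mulr1.
- have [e H] := IH s; exists e => k w Hw; apply: H => i /andP[ni im].
  by apply: Hw; rewrite im (leq_trans nn ni).
Qed.

(** An isomorphism would carry the Rademacher sequence, extended to the line, to a
    bounded sequence in the tree space; small combinations there would come from
    small combinations of Rademacher functions, which do not exist. *)
Lemma tree_space_not_iso : ~ (exists m : nat -> nat, forall j, T (rev (mkseq m j))) ->
  ~ iso_ops (SFspace (tree_space R T)) lineC.
Proof.
move=> nb [u [v [ou ov vu uv]]].
have oE := op_extend R.
have oR : op (A := SFspace (tree_space R T)) (B := cantorC) (@pull R).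
  by apply: op_sub_dom; exact: op_pull.
have oH := op_comp (op_comp oE ov) oR.
have [_ _ /(_ 1%N)[m [C [C0 HC]]]] := ou.
have [_ _ /(_ m)[m' [C' [C'0 HC']]]] := oE.
have [_ _ /(_ m')[m'' [D [D0 HD]]]] := oH.
pose y n := pull (v (extend (rademacher n))).
have dr n : @fdom _ cantorC (rademacher n) by exact: ucontN_rademacher.
have D1 : 0 < D + 1 by rewrite ltr_wpDl.
have Wy n : pruned ((D + 1)^-1 *: y n).
  have dv : SF_set (tree_space R T) (v (extend (rademacher n))).
    by apply: (op_dom ov); apply: (op_dom oE).
  have Wyn : pruned (y n) by split; [exact: (op_dom oR dv)|exact: tree_space_pull].
  by have := pruned_lin (D + 1)^-1 0 Wyn Wyn; rewrite scale0r addr0.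
(* the levels that control the seminorm used to bound u *)
pose L := [set z : nat * bits | exists2 k, (k < m'.+1)%N & z.1 = k].
have nL : no_l1 pruned L.
  apply: no_l1_bigU; first exact: pruned_lin.
  by move=> k; exact: no_l1_level.
have By n : bnd_on L 1 ((D + 1)^-1 *: y n).
  move=> [k w] [j /= jm ->]; rewrite normrM gtr0_norm ?invr_gt0 //.
  rewrite mulrC ler_pdivrMr // mul1r.
  have := HD 1 (rademacher n) (dr n) (@bndN_rademacher n m'') j w jm; rewrite mulr1.
  move/le_trans; apply; lra.
(* combinations smaller than e are sent by u to functions bounded by 1/2 on [-1, 1] *)
pose e := (2 * (C * C' + 1) * (D + 1))^-1.
have CC : 0 < C * C' + 1 by rewrite ltr_wpDl // mulr_ge0.
have e0 : 0 < e by rewrite invr_gt0 !mulr_gt0.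
have [n [k [w0 [bw Bw]]]] := nL e e0 _ Wy By.
have [w [bw' E]] := blk_scale bw.
have [x [bx dx Ew]] := blk_op oH dr bw'.
set f := v (extend x) in Ew.
have df : SF_set (tree_space R T) f by apply: (op_dom ov); exact: (op_dom oE).
have fE : f = extend w by rewrite Ew -(tree_space_pull df).
pose d := (2 * (C * C' + 1))^-1.
have Bf : bndC m (C' * d) f.
  rewrite fE; apply: HC'; first by rewrite Ew; exact: (op_dom oR).
  move=> j t jm; have := Bw (j, t) (ex_intro2 _ _ j jm erefl).
  rewrite E /= normrM gtr0_norm ?invr_gt0 // mulrC ler_pdivrMr //.
  by rewrite /e invfM divfK ?gt_eqF.
have Bu := HC _ f df Bf.
have uf : u f = extend x by rewrite uv //; exact: (op_dom oE).
have [t Ht] := blk_rademacher bx false.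
have := Ht 0%N t (fun _ _ => erefl); rewrite expr0 => x1.
have : `|extend x (eshift 0 (ifs_point (1/3) t))| <= C * (C' * d).
  rewrite -uf; apply: Bu; rewrite /eshift add0r; apply: ifs_point_itv; lra.
have -> : extend x (eshift 0 (ifs_point (1/3) t)) = pull (extend x) (0%N, t) by [].
rewrite extendK // x1 normr1 mulrA /d.
rewrite invfM mulrCA mulrA leNgt => /negP; apply.
have : C * C' / (C * C' + 1) < 1 by rewrite ltr_pdivrMr // mul1r; lra.
lra.
Qed.

End WellFounded.

(** * Borel dependence of the subspace on the tree *)

Section BorelSets.
Variable Z : topologicalType.
Notation Bor := (<<s @open Z >>).

Lemma borel0 : Bor set0.
Proof. by have [] := @smallest_sigma_algebra _ (@setT Z) (@open Z). Qed.
Lemma borelC A : Bor A -> Bor (~` A).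
Proof. by rewrite -setTD; have [_ + _] := @smallest_sigma_algebra _ (@setT Z) (@open Z); exact. Qed.
Lemma borel_bigcup (A : nat -> set Z) : (forall n, Bor (A n)) -> Bor (\bigcup_n A n).
Proof. by have [_ _] := @smallest_sigma_algebra _ (@setT Z) (@open Z); exact. Qed.
Lemma borelT : Bor setT.
Proof. by have := borelC borel0; rewrite setC0. Qed.
Lemma borelU A B : Bor A -> Bor B -> Bor (A `|` B).
Proof. by move=> bA bB; rewrite -bigcup2E; apply: borel_bigcup => -[|[|n]]; [exact: bA|exact: bB|exact: borel0]. Qed.
Lemma borelI A B : Bor A -> Bor B -> Bor (A `&` B).
Proof.
move=> bA bB; rewrite -[A `&` B]setCK setCI; apply: borelC.
by apply: borelU; exact: borelC.
Qed.
Lemma borel_bigcup_count (I : countType) (A : I -> set Z) :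
  (forall i, Bor (A i)) -> Bor (\bigcup_i A i).
Proof.
move=> bA; have -> : \bigcup_i A i =
    \bigcup_n (if @unpickle I n is Some i then A i else set0).
  apply/seteqP; split=> z.
    by move=> [i _ Az]; exists (pickle i) => //; rewrite pickleK.
  by move=> [n _]; case: (@unpickle I n) => // i Az; exists i.
by apply: borel_bigcup => n; case: unpickle => [i|]; [exact: bA|exact: borel0].
Qed.

(** Such an F is a finite Boolean combination of the sets T i; the induction splits
    along the first one and saturates F with respect to the others. *)
Lemma borel_finite_dep (I : eqType) (T : I -> set Z) (l : seq I) (F : set Z) :
  (forall i, Bor (T i)) ->
  (forall z z', {in l, forall i, T i z <-> T i z'} -> F z -> F z') -> Bor F.
Proof.
move=> bT; elim: l F => [|i l IH] F HF.
  have [[z Fz]|F0] := pselect (F !=set0).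
    by rewrite (_ : F = setT); [exact: borelT|apply/seteqP; split=> // z' _; exact: HF Fz].
  by rewrite (_ : F = set0); [exact: borel0|apply/seteqP; split=> // z Fz; apply: F0; exists z].
pose G (P : set Z) : set Z := [set z | exists z', [/\ P z', F z' & {in l, forall j, T j z <-> T j z'}]].
have bG P : Bor (G P).
  apply: IH => z z' zz' [z1 [Pz1 Fz1 zz1]]; exists z1; split=> // j jl.
  by rewrite -zz1 // zz'.
have -> : F = (T i `&` G (T i)) `|` (~` T i `&` G (~` T i)).
  apply/seteqP; split=> z.
    by move=> Fz; have [Tz|nTz] := pselect (T i z); [left|right]; split=> //; exists z.
  have K z' : (T i z <-> T i z') -> F z' -> {in l, forall j, T j z <-> T j z'} -> F z.
    move=> Ti Fz' H; apply: HF Fz' => j; rewrite inE => /orP[/eqP ->|jl]; first by split=> /Ti.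
    by split=> /(H j jl).
  by case=> -[Tz [z' [Tz' Fz' H]]]; apply: (K z').
by apply: borelU; apply: borelI => //; exact: borelC.
Qed.

End BorelSets.

Lemma borel_map_effros (R : realType) (Z : topologicalType) (f : Z -> SF R) :
  (forall U : set (contR R), open U ->
     <<s @open Z >> [set z | SF_set (f z) `&` U !=set0]) -> borel_map f.
Proof.
move=> H E mE.
suff /(_ E) : <<s @effros_gen R >> `<=` [set E | <<s @open Z >> (f @^-1` E)] by apply.
apply: smallest_sub; last by move=> _ [U oU <-]; exact: H.
split=> [|A bA|A bA].
- by rewrite /= preimage_set0; exact: borel0.
- by rewrite /= setTD; exact: borelC.
- by rewrite /= preimage_bigcup; exact: borel_bigcup.
Qed.

Section DenseCodes.
Variable R : realType.

(** Codes for the locally constant rational functions: the value of the code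
    (n, ks, qs) at (k, w) is the entry of qs that has the same position as k and
    the prefix of w of length n in the list ks. *)
Definition simple_code : countType := (nat * seq (nat * seq bool) * seq rat)%type.

Definition simple_fun (c : simple_code) : nat * bits -> R := fun z =>
  ratr (nth 0 c.2 (index (z.1, pref c.1.1 z.2) c.1.2)).

Lemma ucontN_simple c : ucontN (simple_fun c).
Proof. by move=> k e e0; exists c.1.1 => w w' H; rewrite /simple_fun /= H subrr normr0 ltW. Qed.

Definition words n : seq (seq bool) := [seq val t | t <- enum {:n.-tuple bool}].

Lemma mem_words n u : (u \in words n) = (size u == n).
Proof.
apply/mapP/idP => [[t _ ->]|su]; first by rewrite size_tuple.
by exists (Tuple su) => //; rewrite mem_enum.
Qed.

Lemma simple_fun_dense (x : cantorC R) N e : fdom x -> 0 < e -> exists c, bndN N e (x - simple_fun c).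
Proof.
move=> ux e0.
have H k : exists n, forall w w', pref n w = pref n w' -> `|x (k, w) - x (k, w')| <= e / 2.
  by apply: (ux k); rewrite divr_gt0.
have [f Hf] := choice H; have [n Hn] := nat_bound f N.
pose ext (u : seq bool) : bits := fun i => nth false u i.
have Hq (p : nat * seq bool) : exists q : rat, `|x (p.1, ext p.2) - ratr q| <= e / 2.
  have : x (p.1, ext p.2) - e / 2 < x (p.1, ext p.2) + e / 2 by lra.
  move/rat_in_itvoo => [q]; rewrite in_itv /= => /andP[? ?]; exists q.
  by rewrite ler_norml; apply/andP; split; lra.
have [q {}Hq] := choice Hq.
pose ks := [seq (k, u) | k <- iota 0 N.+1, u <- words n].
exists (n, ks, map q ks) => k w kN.
have mk : (k, pref n w) \in ks.
  by apply/allpairsP; exists (k, pref n w); rewrite mem_iota mem_words size_mkseq ltnS kN.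
rewrite -[X in `|X|]/(x (k, w) - ratr (nth 0 (map q ks) (index (k, pref n w) ks))).
rewrite (nth_map (0%N, [::])) ?index_mem // nth_index //.
have := Hq (k, pref n w); rewrite /=.
have pw : pref (f k) w = pref (f k) (ext (pref n w)).
  apply: (@pref_le _ n); first exact: Hn.
  by apply/prefP => i ni; rewrite /ext nth_mkseq.
have := Hf k w _ pw.
by rewrite !ler_norml => /andP[? ?] /andP[? ?]; apply/andP; split; lra.
Qed.

End DenseCodes.

Section Reduction.
Variable R : realType.

(** The first n digits of the retraction involve only finitely many nodes. *)
Lemma prune_finite_dep (T T' : set (seq nat)) n w :
  (forall u, (size u <= n)%N -> T (runs u) <-> T' (runs u)) ->
  pref n (prune T w) = pref n (prune T' w).
Proof.
move=> H; apply/prefP => i ni; rewrite /prune.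
have /asbool_equiv_eq -> // : T (runs (pref i.+1 w)) <-> T' (runs (pref i.+1 w)).
by apply: H; rewrite size_mkseq.
Qed.

(** Each entry n is replaced by the two entries 2n and 2n + 1, so that a branch
    becomes a Cantor set of branches. *)
Definition doubled (T : set (seq nat)) : set (seq nat) := [set s | T (map half s)].

(** The locally constant functions are dense and the projection is continuous, so
    it is enough to test their images. *)
Lemma tree_space_meets (T : set (seq nat)) (T0 : T [::]) (Tcl : forall n s, T (n :: s) -> T s)
    (U : set (contR R)) : open U ->
  SF_set (tree_space R T) `&` U !=set0 <-> exists c, U (extend (prune_op T (simple_fun R c))).
Proof.
move=> /contR_openP oU; split; last first.
  move=> [c Uc]; exists (extend (prune_op T (simple_fun R c))); split=> //.
  apply: tree_space_prune => //; exact: ucontN_simple.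
move=> [f [Xf Uf]]; have [n [e [e0 H]]] := oU f Uf.
have oM : op (fun x : cantorC R => extend (prune_op T x) : lineC R).
  exact: (op_comp (op_prune R T) (op_extend R)).
have [_ _ /(_ n)[m [C [C0 HC]]]] := oM.
have C1 : 0 < C + 1 by rewrite ltr_wpDl.
have uf : @fdom _ (cantorC R) (pull f) by apply: (op_dom (op_pull R)).
have [c Hc] := simple_fun_dense m uf (divr_gt0 e0 C1).
exists c; apply: H; rewrite -opprB; apply: bndCN.
have uc : @fdom _ (cantorC R) (simple_fun R c) by exact: ucontN_simple.
have fE : f = extend (prune_op T (pull f)) by [].
rewrite [X in X - _]fE -(opB oM uf uc).
apply: bndC_le (HC _ _ (fdomB uf uc) Hc).
exact: mul_div_succ_le.
Qed.

(** The image of a locally constant function depends on finitely many nodes of the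
    tree. *)
Lemma borel_tree_space (Z : topologicalType) (T : Z -> set (seq nat)) :
  (forall z, T z [::]) -> (forall z n s, T z (n :: s) -> T z s) ->
  (forall s, <<s @open Z >> [set z | T z s]) -> borel_map (fun z => tree_space R (T z)).
Proof.
move=> T0 Tcl bT; apply: borel_map_effros => U oU.
have -> : [set z | SF_set (tree_space R (T z)) `&` U !=set0] =
    \bigcup_c [set z | U (extend (prune_op (T z) (simple_fun R c)))].
  apply/seteqP; split=> z; first by move/(tree_space_meets (T0 z) (Tcl z) oU) => [c Uc]; exists c.
  by move=> [c _ Uc]; apply/(tree_space_meets (T0 z) (Tcl z) oU); exists c.
apply: borel_bigcup_count => c.
pose n := c.1.1.
apply: (@borel_finite_dep _ _ (fun s => [set z | T z s])
  [seq runs u | u <- flatten [seq words k | k <- iota 0 n.+1]]) => // z z' H.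
rewrite /=; suff -> : prune_op (T z) (simple_fun R c) = prune_op (T z') (simple_fun R c) by [].
apply/funext => -[k w]; rewrite /prune_op /compose_bits /simple_fun /= (@prune_finite_dep (T z) (T z')) // => u un.
apply: H; apply/mapP; exists u => //; apply/flattenP; exists (words (size u)).
  by apply/mapP; exists (size u) => //; rewrite mem_iota.
by rewrite mem_words.
Qed.

Lemma doubled_branch (T : set (seq nat)) :
  (exists m : nat -> nat, forall j, doubled T (rev (mkseq m j))) ->
  exists x : nat -> nat, forall j, T (rev (mkseq x j)).
Proof.
move=> [m Hm]; exists (half \o m) => j; have := Hm j.
by rewrite /doubled /= map_rev /mkseq -map_comp.
Qed.

Lemma branch_doubled (T : set (seq nat)) (x : nat -> nat) : (forall j, T (rev (mkseq x j))) ->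
  forall u j, doubled T (rev (mkseq (branch_run x u) j)).
Proof.
move=> H u j; rewrite /doubled /= map_rev /mkseq -map_comp.
rewrite (@eq_map _ _ (half \o branch_run x u) x); first exact: H.
by move=> i /=; rewrite /branch_run addnC half_bit_double.
Qed.

Lemma tree_space_iso_class (T : set (seq nat)) : T [::] -> (forall n s, T (n :: s) -> T s) ->
  iso_class (SFT R) (tree_space R (doubled T)) <-> exists x : nat -> nat, forall j, T (rev (mkseq x j)).
Proof.
move=> T0 Tcl; have Dcl : forall n s, doubled T (n :: s) -> doubled T s.
  by move=> n s; exact: Tcl.
split.
  move/iso_ops_lin_isomorphic => H; apply: doubled_branch; apply: contrapT => nb.
  exact: (tree_space_not_iso Dcl nb H).
move=> [x Hx]; apply/iso_ops_lin_isomorphic.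
exact: (tree_space_iso_lineC R T0 Dcl (branch_doubled Hx)).
Qed.

End Reduction.

(** * Analytic sets and trees *)

Section AnalyticTree.
Variable R : realType.

Lemma polish_seq (Y : topologicalType) (dist : Y -> Y -> R) (D : set Y) :
  countable D -> dense D ->
  (forall (x : Y) (U : set Y), nbhs x U <->
     exists2 e, 0 < e & [set y | dist x y < e] `<=` U) -> Y ->
  exists e : nat -> Y, forall y d, 0 < d -> exists n, dist y (e n) < d.
Proof.
move=> /countable_injP[g injg] dD nb y0.
have H n : exists d, (exists2 d', D d' & g d' = n) -> D d /\ g d = n.
  have [[d Dd gd]|nd] := pselect (exists2 d', D d' & g d' = n); first by exists d.
  by exists y0.
have [e He] := choice H.
exists e => y d dp.
have N : nbhs y [set x | dist y x < d] by apply/nb; exists d.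
have [x [Dx xU]] : D `&` ([set x | dist y x < d])° !=set0.
  rewrite setIC; apply: dD; last exact: open_interior.
  by exists y; exact: N.
have xd : dist y x < d by exact: (interior_subset xU).
have [De ge] := He (g x) (ex_intro2 _ _ x Dx erefl).
by exists (g x); have -> : e (g x) = x by apply: injg; rewrite ?inE.
Qed.

Local Notation r := (@hpow R).

Section Tree.
Variables (Y Z : topologicalType) (f : Y -> Z) (dY : Y -> Y -> R) (dZ : Z -> Z -> R).
Variable e : nat -> Y.

(** The nodes are the finite sequences (s_0, ..., s_k) such that the points e_(s_i)
    of the dense sequence approach each other geometrically and each has, at
    distance less than 2^-i, a point whose image is at distance less than 2^-i
    from z.  Asking for a nearby point instead of the image of e_(s_i) itself
    makes a branch exist for every preimage of z, whatever the modulus of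
    continuity of f. *)
Fixpoint atree (z : Z) (s : seq nat) : Prop := if s is n :: s' then
  [/\ atree z s', exists y, dY (e n) y < r (size s') /\ dZ (f y) z < r (size s') &
      if s' is m :: s'' then dY (e m) (e n) < 2 * r (size s'') else True]
  else True.

Hypotheses (mY : is_metric dY) (mZ : is_metric dZ).
Hypothesis nY : forall (x : Y) (U : set Y), nbhs x U <->
     exists2 e, 0 < e & [set y | dY x y < e] `<=` U.
Hypothesis nZ : forall (x : Z) (U : set Z), nbhs x U <->
     exists2 e, 0 < e & [set y | dZ x y < e] `<=` U.
Hypothesis cY : forall u : nat -> Y,
          (forall e, 0 < e -> exists N, forall m n,
             (N <= m)%N -> (N <= n)%N -> dY (u m) (u n) < e) ->
          exists l : Y, u @ \oo --> l.
Hypothesis He : forall y d, 0 < d -> exists n, dY y (e n) < d.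
Hypothesis cf : continuous f.

Lemma atree_open s : open [set z | atree z s].
Proof.
elim: s => [|n s IH] /=.
  by rewrite (_ : [set _ | _] = setT); [exact: openT|apply/seteqP; split].
have -> : [set z | [/\ atree z s, exists y, dY (e n) y < r (size s) /\ dZ (f y) z < r (size s) &
      if s is m :: s'' then dY (e m) (e n) < 2 * r (size s'') else True]] =
   [set z | atree z s] `&` [set z | exists y, dY (e n) y < r (size s) /\ dZ (f y) z < r (size s)]
   `&` [set z | if s is m :: s'' then dY (e m) (e n) < 2 * r (size s'') else True].
  by apply/seteqP; split=> z /=; [move=> []|move=> [[]]].
have [Z1 Z2 Z3 Z4] := mZ.
apply: openI; first apply: openI => //.
  rewrite openE => z /= [y [ey fz]]; apply/nZ.
  exists (r (size s) - dZ (f y) z); first by rewrite subr_gt0.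
  move=> z' /= zz'; exists y; split=> //.
  by apply: le_lt_trans (Z4 _ z _) _; lra.
have [H|H] := pselect (if s is m :: s'' then dY (e m) (e n) < 2 * r (size s'') else True).
  by rewrite (_ : [set _ | _] = setT); [exact: openT|apply/seteqP; split].
by rewrite (_ : [set _ | _] = set0); [exact: open0|apply/seteqP; split].
Qed.

Lemma atree_branch z : range f z <-> exists x : nat -> nat, forall n, atree z (rev (mkseq x n)).
Proof.
have [Z1 Z2 Z3 Z4] := mZ; have [Y1 Y2 Y3 Y4] := mY.
split.
  move=> [y _ fy].
  have [x Hx] := choice (fun k => He y (hpow_gt0 R k)).
  exists x; elim=> [//|n IH].
  rewrite mkseqS rev_rcons /= size_rev size_mkseq; split=> //.
    exists y; split; first by rewrite Y3.
    by rewrite fy (Z2 z z).2 // hpow_gt0.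
  case: n {IH} => [|n]; rewrite ?mkseqS ?rev_rcons //= size_rev size_mkseq.
  apply: le_lt_trans (Y4 _ y _) _; rewrite Y3.
  have := Hx n; have := Hx n.+1; rewrite hpowS; have := hpow_gt0 R n; lra.
move=> [x Hx].
have A1 k : exists y, dY (e (x k)) y < r k /\ dZ (f y) z < r k.
  by have := Hx k.+1; rewrite mkseqS rev_rcons /= size_rev size_mkseq => -[].
have A2 k : dY (e (x k)) (e (x k.+1)) < 2 * r k.
  by have := Hx k.+2; rewrite !mkseqS !rev_rcons /= !size_rev !size_mkseq => -[].
have A3 N j : dY (e (x N)) (e (x (N + j)%N)) <= 4 * r N - 4 * r (N + j).
  elim: j => [|j IH]; first by rewrite addn0 (Y2 _ _).2 // subrr.
  rewrite addnS; apply: (le_trans (Y4 _ (e (x (N + j)%N)) _)).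
  have := A2 (N + j)%N; rewrite hpowS; lra.
have A4 N k : (N <= k)%N -> dY (e (x N)) (e (x k)) <= 4 * r N.
  by move=> Nk; have := A3 N (k - N)%N; rewrite subnKC //; have := hpow_gt0 R k; lra.
have [l ul] : exists l : Y, (fun k => e (x k)) @ \oo --> l.
  apply: cY => d d0; have [N HN] := hpow_small (divr_gt0 d0 (ltr0n _ 8)).
  exists N => m n Nm Nn; apply: le_lt_trans (Y4 _ (e (x N)) _) _; rewrite Y3.
  have := A4 N m Nm; have := A4 N n Nn; have := HN N (leqnn N); lra.
exists l => //; apply/Z2/le0_eps => d d0.
rewrite ger0_norm ?Z1 //.
have [a a0 Ha] : exists2 a, 0 < a & [set y | dY l y < a] `<=` f @^-1` [set z | dZ (f l) z < d / 2].
  by apply/nY; apply: cf; apply/nZ; exists (d / 2); rewrite ?divr_gt0.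
have NA : nbhs l [set y | dY l y < a / 2] by apply/nY; exists (a / 2); rewrite ?divr_gt0.
have [N1 _ HN1] := ul _ NA.
have [N2 HN2] := hpow_small (divr_gt0 a0 (ltr0n _ 2)).
have [N3 HN3] := hpow_small (divr_gt0 d0 (ltr0n _ 2)).
pose k := maxn N1 (maxn N2 N3).
have [y [yk fyz]] := A1 k.
have h1 : dY l (e (x k)) < a / 2 by apply: HN1; rewrite /= leq_maxl.
have h2 : r k < a / 2 by apply: HN2; rewrite leq_max leq_maxl orbT.
have h3 : r k < d / 2 by apply: HN3; rewrite leq_max leq_maxr orbT.
have : dZ (f l) (f y) < d / 2.
  by apply: Ha => /=; apply: le_lt_trans (Y4 _ (e (x k)) _) _; lra.
have := Z4 (f l) (f y) z; lra.
Qed.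

End Tree.

Lemma analytic_tree (Z : topologicalType) (B : set Z) :
  polish_space R Z -> analytic_polish R B -> exists T : Z -> set (seq nat),
  [/\ forall z, T z [::], forall z n s, T z (n :: s) -> T z s,
      forall s, open [set z | T z s] &
      forall z, B z <-> exists x : nat -> nat, forall n, T z (rev (mkseq x n))].
Proof.
move=> [_ [dZ [mZ nZ _]]] [Y [f [[[D cD dD] [dY [mY nY cY]]] cf <-]]].
have [[y0]|Y0] := pselect (inhabited Y); last first.
  exists (fun _ => [set [::]]); split=> //.
    move=> s; have [->|ns] := eqVneq s [::].
      by rewrite (_ : [set _ | _] = setT); [exact: openT|apply/seteqP; split].
    rewrite (_ : [set _ | _] = set0); first exact: open0.
    by apply/seteqP; split=> // z /= E; rewrite E eqxx in ns.
  move=> z; split; first by move=> [y _ _]; case: Y0; exists.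
  by move=> [x /(_ 1%N)].
have [e He] := polish_seq cD dD nY y0.
exists (atree f dY dZ e); split=> //.
- by move=> z n s [].
- exact: (atree_open f dY e mZ nZ).
- move=> z; exact: (atree_branch mY mZ nY nZ cY He cf).
Qed.

End AnalyticTree.

Lemma iso_class_hard (R : realType) (Z : topologicalType) (B : set Z) :
  polish_space R Z -> analytic_polish R B ->
  exists f : Z -> SF R, borel_map f /\ f @^-1` (iso_class (SFT R)) = B.
Proof.
move=> pZ aB; have [T [T0 Tcl oT BT]] := analytic_tree pZ aB.
exists (fun z => tree_space R (doubled (T z))); split.
  apply: borel_tree_space => [z|z n s|s].
  - exact: T0.
  - exact: Tcl.
  - by apply: sub_sigma_algebra; exact: oT.
apply/seteqP; split=> z.
  by move/(tree_space_iso_class R (T0 z) (Tcl z)) => ?; apply/BT.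
by move/BT => ?; apply/(tree_space_iso_class R (T0 z) (Tcl z)).
Qed.

(** * Closed subsets of the Baire space *)

Definition agree (n : nat) (x y : nat -> nat) := forall i, (i < n)%N -> x i = y i.

Lemma agree_le m n x y : (m <= n)%N -> agree n x y -> agree m x y.
Proof. by move=> mn H i im; apply: H; exact: leq_trans mn. Qed.

Definition seqspace (P : set (nat -> nat)) := {y : nat -> nat | P y}.

Section SeqSpace.
Variable P : set (nat -> nat).
Notation S := (seqspace P).

HB.instance Definition _ := gen_eqMixin S.
HB.instance Definition _ := gen_choiceMixin S.

Definition snbhs (y : S) : set_system S :=
  [set U | exists n, forall y' : S, agree n (sval y) (sval y') -> U y'].

HB.instance Definition _ := hasNbhs.Build S snbhs.

Let snbhs_filter (y : S) : ProperFilter (nbhs y).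
Proof.
split.
  by move=> [n /(_ y)]; apply.
split.
- by exists 0%N.
- move=> U V [n Hn] [m Hm]; exists (maxn n m) => y' H; split.
    by apply: Hn; apply: agree_le H; exact: leq_maxl.
  by apply: Hm; apply: agree_le H; exact: leq_maxr.
- by move=> U V UV [n Hn]; exists n => y' /Hn; exact: UV.
Qed.

Let snbhs_singleton (y : S) (A : set S) : nbhs y A -> A y.
Proof. by move=> [n]; apply. Qed.

Let snbhs_nbhs (y : S) (A : set S) : nbhs y A -> nbhs y (nbhs^~ A).
Proof.
move=> [n Hn]; exists n => y' yy'; exists n => y'' yy''; apply: Hn => i ni.
by rewrite yy' // yy''.
Qed.

HB.instance Definition _ :=
  Nbhs_isNbhsTopological.Build S snbhs_filter snbhs_singleton snbhs_nbhs.

Lemma snbhsE (y : S) (U : set S) :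
  nbhs y U <-> exists n, forall y' : S, agree n (sval y) (sval y') -> U y'.
Proof. by []. Qed.

Variable R : realType.
Local Notation r := (@hpow R).

(** The ultrametric 2^-n, n being the first place of difference. *)
Definition sdist (y y' : S) : R :=
  if pselect (exists n, sval y n != sval y' n) is left H then r (ex_minn H) else 0.

Lemma sdist_le y y' n : (sdist y y' <= r n) <-> agree n (sval y) (sval y').
Proof.
rewrite /sdist; case: pselect => [H|H]; last first.
  split=> _; last exact/ltW/hpow_gt0.
  by move=> i _; apply/eqP; apply: contrapT => /negP h; apply: H; exists i.
case: ex_minnP => m Hm mmin; rewrite ler_hpow; split=> [nm i ni|A].
  apply/eqP; apply: contrapT => /negP h.
  by have := leq_trans ni nm; rewrite ltnNge mmin.
by rewrite leqNgt; apply/negP => mn; rewrite (A m mn) eqxx in Hm.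
Qed.

Lemma sdist_lt y y' n : sdist y y' < r n -> agree n.+1 (sval y) (sval y').
Proof.
rewrite -sdist_le /sdist; case: pselect => [H|H] h; last exact/ltW/hpow_gt0.
by rewrite ler_hpow -(ltr_hpow R).
Qed.

Lemma seqspace_eq (y y' : S) : (forall n, agree n (sval y) (sval y')) -> y = y'.
Proof.
case: y y' => [y Py] [y' Py'] /= H.
have E : y = y' by apply/funext => i; exact: (H i.+1).
by subst y'; congr exist; exact: Prop_irrelevance.
Qed.

Lemma sdist_metric : is_metric sdist.
Proof.
have dge0 y y' : 0 <= sdist y y'.
  by rewrite /sdist; case: pselect => // H; exact/ltW/hpow_gt0.
split=> //.
- move=> y y'; split=> [E|->].
    by apply: seqspace_eq => n; rewrite -sdist_le E; exact/ltW/hpow_gt0.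
  by rewrite /sdist; case: pselect => // H; exfalso; case: H => n; rewrite eqxx.
- move=> y y'; rewrite /sdist.
  case: pselect => [H|H]; case: pselect => [H'|H'] //.
  + congr (hpow _ _); case: ex_minnP => m Hm mmin; case: ex_minnP => m' Hm' mmin'.
    by apply/eqP; rewrite eqn_leq mmin ?mmin' // eq_sym.
  + by exfalso; apply: H'; have [n Hn] := H; exists n; rewrite eq_sym.
  + by exfalso; apply: H; have [n Hn] := H'; exists n; rewrite eq_sym.
move=> x y z; rewrite leNgt; apply/negP => h.
move: (h); rewrite {3}/sdist; case: pselect => [H|H]; last by have := dge0 x y; have := dge0 y z; lra.
case: ex_minnP => m Hm _ hm.
have /sdist_lt A1 : sdist x y < r m by have := dge0 y z; lra.
have /sdist_lt A2 : sdist y z < r m by have := dge0 x y; lra.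
by rewrite (A1 m) // (A2 m) // eqxx in Hm.
Qed.

Hypothesis Pcl : forall y, (forall n, exists2 y', P y' & agree n y y') -> P y.

(** A dense set is obtained by choosing, for each finite sequence that has an
    extension in P, one such extension. *)
Lemma seqspace_polish : polish_space R S.
Proof.
split.
  have H (s : seq nat) : exists o : option S, forall y : S, mkseq (sval y) (size s) = s ->
      exists2 y', o = Some y' & mkseq (sval y') (size s) = s.
    have [[y Hy]|nH] := pselect (exists y : S, mkseq (sval y) (size s) = s).
      by exists (Some y) => _ _; exists y.
    by exists None => y Hy; case: nH; exists y.
  have [F HF] := choice H.
  exists [set y | exists s, F s = Some y].
    apply/countable_injP.
    have H' (y : S) : exists s, (exists s, F s = Some y) -> F s = Some y.
      have [[s Hs]|nH] := pselect (exists s, F s = Some y); first by exists s.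
      by exists [::].
    have [g Hg] := choice H'.
    exists (fun y => pickle (g y)) => y y'; rewrite !inE => /Hg e /Hg e'.
    by move=> /(pcan_inj pickleK) E; move: e; rewrite E e' => -[].
  move=> O [y Oy] oO.
  have : nbhs y O by apply: open_nbhs_nbhs.
  move=> [n Hn].
  have sz : size (mkseq (sval y) n) = n by rewrite size_mkseq.
  have [|y' Fy' E] := HF (mkseq (sval y) n) y; first by rewrite sz.
  exists y'; split; last by exists (mkseq (sval y) n).
  apply: Hn => i ni; have := congr1 (fun s => nth 0%N s i) E.
  by rewrite sz !nth_mkseq.
exists sdist; split.
- exact: sdist_metric.
- move=> y U; rewrite snbhsE; split.
    move=> [n Hn]; exists (r n); first exact: hpow_gt0.
    by move=> y' /= /sdist_lt h; apply: Hn; apply: agree_le h.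
  move=> [e e0 He]; have [N HN] := hpow_small e0.
  exists N => y' /sdist_le h; apply: He; apply: le_lt_trans h _; exact: HN.
move=> u Cu.
have H n : exists N, forall i j, (N <= i)%N -> (N <= j)%N -> agree n.+1 (sval (u i)) (sval (u j)).
  have [N HN] := Cu _ (hpow_gt0 R n); exists N => i j Ni Nj; apply: sdist_lt; exact: HN.
have [N HN] := choice H.
pose l n := sval (u (N n)) n.
have Hl n i : (forall k, (k < n)%N -> (N k <= i)%N) -> agree n l (sval (u i)).
  by move=> Hi k kn; apply: (HN k _ _ (leqnn _)) => //; exact: Hi.
have Pl : P l.
  apply: Pcl => n; have [M HM] := nat_bound N n.
  exists (sval (u M)); first exact: (svalP (u M)).
  by apply: Hl => k kn; apply: HM; exact: ltnW.
exists (exist _ l Pl) => U [n Hn].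
have [M HM] := nat_bound N n.
exists M => // i /= Mi; apply: Hn => /=; apply: Hl => k kn.
by apply: leq_trans Mi; apply: HM; exact: ltnW.
Qed.

End SeqSpace.

(** * Codes for the embeddings of C(R) into itself *)

Section IsoClassAnalytic.
Variable R : realType.
Notation CR := (contR R).
Notation lineC := (lineC R).
Local Notation r := (@hpow R).

Definition dseq (k : nat) : CR := if unpickle k is Some c then Milutin_lift (simple_fun R c) else 0.

Lemma dseq_dense (f : CR) N (e : R) : 0 < e -> exists k, bndC N e (f - dseq k).
Proof.
move=> e0; have [_ _ /(_ N)[m [C [C0 HC]]]] := op_Milutin_lift R.
have C1 : 0 < C + 1 by rewrite ltr_wpDl.
have uf : @fdom _ (cantorC R) (Milutin_pull f) by apply: (op_dom (op_Milutin_pull R)).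
have [c Hc] := simple_fun_dense m uf (divr_gt0 e0 C1).
exists (pickle c); rewrite /dseq pickleK -[f]Milutin_liftK.
have uc : @fdom _ (cantorC R) (simple_fun R c) by exact: ucontN_simple.
rewrite -(opB (op_Milutin_lift R) uf uc).
apply: bndC_le (HC _ _ (fdomB uf uc) Hc).
exact: mul_div_succ_le.
Qed.

Variables (code : nat * nat -> nat) (unc : nat -> nat * nat).
Hypothesis codeK : cancel code unc.

(** A code holds the constants [gauge y n], used both as the index of a seminorm
    and as a factor, and the numbers [approx y k i] of members of the dense
    sequence that approximate the value of h on its k-th member. *)
Definition gauge (y : nat -> nat) n := y (code (0%N, n)).
Definition approx (y : nat -> nat) k i := y (code (k.+1, i)).

Definition coded_by (h : CR -> CR) (y : nat -> nat) := [/\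
  forall (a : R) u v, h (a *: u + v) = a *: h u + h v,
  forall n c f, bndC (gauge y n) c f -> bndC n ((gauge y n)%:R * c) (h f),
  forall n c f, bndC (gauge y n) c (h f) -> bndC n ((gauge y n)%:R * c) f &
  forall k i, bndC i (r i) (h (dseq k) - dseq (approx y k i))].

(** The predicate quantifies over h; that it is closed is shown by a limit of
    embeddings, not by spelling out conditions on the code. *)
Definition embedding_codes : set (nat -> nat) := [set y | exists h, coded_by h y].

Lemma coded_byB h y u v : coded_by h y -> h (u - v) = h u - h v.
Proof.
move=> [hl _ _ _]; have := hl (-1) v u; rewrite !scaleN1r => E.
by rewrite addrC E addrC.
Qed.

Lemma coded_by0 h y : coded_by h y -> h 0 = 0.
Proof. by move=> g; have := coded_byB 0 0 g; rewrite !subrr. Qed.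

(** On a compact set, h f is known up to e from finitely many coordinates of the
    code, and these coordinates depend on h only through one constant. *)
Lemma coded_by_approx (f : CR) N p (e : R) : 0 < e -> exists k i, forall h y, coded_by h y ->
  gauge y N = p -> bndC N e (h f - dseq (approx y k i)).
Proof.
move=> e0; have e20 : 0 < e / 2 by rewrite divr_gt0.
have p1 : 0 < (p%:R + 1 : R) by rewrite ltr_wpDl.
have [k Hk] := dseq_dense f p (divr_gt0 e20 p1).
have [M HM] := hpow_small e20.
exists k, (maxn N M) => h y g E; have [_ h1 _ h2] := g.
have -> : h f - dseq (approx y k (maxn N M)) =
   h (f - dseq k) + (h (dseq k) - dseq (approx y k (maxn N M))).
  by rewrite (coded_byB _ _ g) addrA subrK.
rewrite (splitr e); apply: bndCD.
  have := h1 N (e / 2 / (p%:R + 1)) (f - dseq k); rewrite E => /(_ Hk); apply: bndC_le.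
  exact/mul_div_succ_le.
apply: bndC_le (bndC_lev (leq_maxl N M) (h2 k (maxn N M))).
by apply/ltW/HM; exact: leq_maxr.
Qed.

Lemma bndC_dist N (c d : R) (f g k : CR) : bndC N c (f - k) -> bndC N d (g - k) ->
  bndC N (c + d) (f - g).
Proof.
move=> H /bndCN; rewrite opprB => K; have := bndCD H K.
by rewrite addrA subrK.
Qed.

Lemma bndC_dist' N (c d : R) (f g k : CR) : bndC N c (f - g) -> bndC N d (f - k) ->
  bndC N (c + d) (k - g).
Proof.
move=> H /bndCN K; have := bndCD H K.
by rewrite opprB [X in bndC _ _ X]addrC addrA subrK.
Qed.

Lemma bndC0_eq (f : CR) : (forall N e, 0 < e -> bndC N e f) -> f = 0.
Proof.
move=> H; apply: contR_eq => t; apply/le0_eps => e e0.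
by apply: (H (Num.truncn `|t|).+1 e e0); exact/ltW/truncnS_gt.
Qed.

Lemma bndC_eps N (c : R) (f : CR) : (forall e, 0 < e -> bndC N (c + e) f) -> bndC N c f.
Proof. by move=> H t tn; apply: ler_eps => e e0; exact: H. Qed.

Lemma coded_by_local h h' y y' (f : CR) N (e : R) k i : 0 < e ->
  (forall h y, coded_by h y -> gauge y N = gauge y' N -> bndC N (e / 2) (h f - dseq (approx y k i))) ->
  coded_by h y -> coded_by h' y' -> gauge y N = gauge y' N -> approx y k i = approx y' k i ->
  bndC N e (h f - h' f).
Proof.
move=> e0 H g g' E E'; rewrite (splitr e).
apply: (@bndC_dist _ _ _ _ _ (dseq (approx y' k i))); last exact: H.
by rewrite -E'; exact: H.
Qed.

Lemma coded_by_uniq h h' y : coded_by h y -> coded_by h' y -> forall f, h f = h' f.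
Proof.
move=> g g' f; apply/eqP; rewrite -subr_eq0; apply/eqP/bndC0_eq => N e e0.
have [k [i H]] := coded_by_approx f N (gauge y N) (divr_gt0 e0 (ltr0n _ 2)).
exact: (coded_by_local e0 H g g').
Qed.

(** Embeddings whose codes converge to y have eventually the same constants, so by
    [coded_by_local] they converge on every f; linearity and the two-sided
    estimates pass to the limit. *)
Lemma embedding_codes_closed y : (forall n, exists2 y', embedding_codes y' & agree n y y') -> embedding_codes y.
Proof.
move=> H.
have H' n : exists yh : (nat -> nat) * (CR -> CR), coded_by yh.2 yh.1 /\ agree n y yh.1.
  by have [y' [h g] A] := H n; exists (y', h).
have [yh Hyh] := choice H'.
pose Y n := (yh n).1; pose h n := (yh n).2.
have gn n : coded_by (h n) (Y n) by have [] := Hyh n.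
have An n j : (n < j)%N -> Y j n = y n by move=> nj; have [_ /(_ n nj)] := Hyh j.
have cau f : forall N e, 0 < e -> exists n0, forall i j, (n0 <= i)%N -> (n0 <= j)%N ->
    bndC N e (h i f - h j f).
  move=> N e e0.
  have [k [i Hki]] := coded_by_approx f N (gauge y N) (divr_gt0 e0 (ltr0n _ 2)).
  exists (maxn (code (0, N)) (code (k.+1, i))).+1%N => a b; rewrite !gtn_max.
  move=> /andP[a1 a2] /andP[b1 b2].
  have E1 : gauge (Y a) N = gauge y N by exact: An.
  have E2 : gauge (Y b) N = gauge y N by exact: An.
  have E3 : approx (Y a) k i = approx (Y b) k i by rewrite /approx !An.
  apply: (coded_by_local e0 _ (gn a) (gn b) _ E3); last by rewrite E1 E2.
  by rewrite E2.
have lim f : exists g, forall N e, 0 < e -> exists n0, forall n, (n0 <= n)%N ->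
    bndC N e (h n f - g).
  have [g Hg] := contR_complete (cau f).
  exists g => N e e0; have [n0 Hn0] := cau f N e e0; exists n0.
  exact: Hg.
have [l Hl] := choice lim.
have ev f N (e : R) : 0 < e -> forall m, exists2 n, (m <= n)%N & bndC N e (h n f - l f).
  by move=> e0 m; have [n0 K] := Hl f N e e0; exists (maxn m n0);
     [exact: leq_maxl|apply: K; exact: leq_maxr].
exists l; split.
- move=> a u v; apply/eqP; rewrite -subr_eq0; apply/eqP/bndC0_eq => N e e0.
  have a1 : 0 < `|a| + 2 by rewrite ltr_wpDl.
  have d0 := divr_gt0 e0 a1; set d := e / (`|a| + 2) in d0.
  have [n1 K1] := Hl (a *: u + v) N d d0.
  have [n2 K2] := Hl u N d d0.
  have [n3 K3] := Hl v N d d0.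
  pose n := maxn n1 (maxn n2 n3).
  have := K1 n ltac:(by rewrite leq_maxl).
  have := K2 n ltac:(by rewrite leq_max leq_maxl orbT).
  have := K3 n ltac:(by rewrite leq_max leq_maxr orbT).
  have [-> _ _ _] := gn n => L3 L2 /bndCN L1.
  have := bndCD (bndC_lin a L2 L3) L1.
  have -> : a *: (h n u - l u) + (h n v - l v) - (a *: h n u + h n v - l (a *: u + v)) =
     l (a *: u + v) - (a *: l u + l v).
    by apply: contR_eq => t; rewrite !(contRDE, contRNE, contRZE); ring.
  apply: bndC_le.
  have -> : `|a| * d + d + d = d * (`|a| + 2) by ring.
  by rewrite /d divfK // gt_eqF.
- move=> N c f bf; apply: bndC_eps => e e0.
  have [n nN K] := ev f N e e0 (code (0, N)).+1%N.
  have [_ h1 _ _] := gn n.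
  have E : gauge (Y n) N = gauge y N by exact: An.
  have := h1 N c f; rewrite E => /(_ bf) B; rewrite -[h n f]subr0 in B.
  by have := bndC_dist' B K; rewrite subr0.
- move=> N c f bf; apply: bndC_eps => e e0.
  have p1 : 0 < ((gauge y N)%:R + 1 : R) by rewrite ltr_wpDl.
  have d0 := divr_gt0 e0 p1; set d := e / _ in d0.
  have [n nN K] := ev f (gauge y N) d d0 (code (0, N)).+1%N.
  have [_ _ h1 _] := gn n.
  have E : gauge (Y n) N = gauge y N by exact: An.
  have dle : (gauge y N)%:R * d <= e by exact: mul_div_succ_le.
  have B : bndC (gauge y N) (d + c) (h n f) by have := bndCD K bf; rewrite subrK.
  have := h1 N (d + c) f; rewrite E => /(_ B); apply: bndC_le.
  rewrite mulrDr; lra.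
- move=> k i; apply: bndC_eps => e e0.
  have [n nN K] := ev (dseq k) i e e0 (code (k.+1, i)).+1%N.
  have [_ _ _ h1] := gn n.
  have E : approx (Y n) k i = approx y k i by exact: An.
  by have := bndC_dist' (h1 k i) K; rewrite E.
Qed.

(** By the lower estimate, preimages of a convergent sequence form a Cauchy
    sequence. *)
Lemma closed_coded_range h y : coded_by h y -> closed (range h).
Proof.
move=> g f clf; have [_ h1 h2 _] := g.
have H j : exists u, bndC j (r j) (h u - f).
  have : nbhs f [set k | bndC j (r j) (k - f)] by apply/contR_nbhsP; exists j, (r j); split; first exact: hpow_gt0.
  by move/clf => [_ [[u _ <-] Hu]]; exists u.
have [u Hu] := choice H.
have near N (e : R) : 0 < e -> exists n0, forall i, (n0 <= i)%N -> bndC N e (h (u i) - f).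
  move=> e0; have [M HM] := hpow_small e0; exists (maxn N M) => i; rewrite geq_max => /andP[Ni Mi].
  by apply: bndC_le (bndC_lev Ni (Hu i)); exact/ltW/HM.
have small N (e : R) : 0 < e -> exists2 d : R, 0 < d & (gauge y N)%:R * d <= e.
  move=> e0; have p1 : 0 < ((gauge y N)%:R + 1 : R) by rewrite ltr_wpDl.
  by exists (e / ((gauge y N)%:R + 1)); [exact: divr_gt0|exact: mul_div_succ_le].
have [l Hl] : exists l, forall N e n0, 
    (forall i j, (n0 <= i)%N -> (n0 <= j)%N -> bndC N e (u i - u j)) ->
    forall i, (n0 <= i)%N -> bndC N e (u i - l).
  apply: contR_complete => N e e0; have [d d0 dle] := small N e e0.
  have [n0 Hn0] := near (gauge y N) (d / 2) (divr_gt0 d0 (ltr0n _ 2)).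
  exists n0 => i j ni nj; apply: bndC_le dle _; apply: h2.
  by rewrite (coded_byB _ _ g) (splitr d); apply: bndC_dist; exact: Hn0.
exists l => //; apply/eqP; rewrite -subr_eq0; apply/eqP/bndC0_eq => N e e0.
have e20 : 0 < e / 2 by rewrite divr_gt0.
have [d d0 dle] := small N _ e20.
have [d' d'0 d'le] := small (gauge y N) _ d0.
have [n0 Hn0] := near (gauge y (gauge y N)) (d' / 2) (divr_gt0 d'0 (ltr0n _ 2)).
have [n1 Hn1] := near N _ e20.
have C i j : (n0 <= i)%N -> (n0 <= j)%N -> bndC (gauge y N) d (u i - u j).
  move=> ni nj; apply: bndC_le d'le _; apply: h2.
  by rewrite (coded_byB _ _ g) (splitr d'); apply: bndC_dist; exact: Hn0.
have K := Hl _ _ _ C (maxn n0 n1) (leq_maxl _ _).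
have L := h1 N _ _ K; rewrite (coded_byB _ _ g) in L.
by apply: bndC_le (bndC_dist' (Hn1 (maxn n0 n1) (leq_maxr _ _)) L); lra.
Qed.

Lemma coded_range_lin h y : coded_by h y -> forall (a : R) u v, range h u -> range h v ->
  range h (a *: u + v).
Proof. by move=> [hl _ _ _] a _ _ [u _ <-] [v _ <-]; exists (a *: u + v) => //; rewrite hl. Qed.

Lemma coded_range0 h y : coded_by h y -> range h 0.
Proof. by move=> g; exists 0 => //; exact: coded_by0 g. Qed.

Definition embedding (y : seqspace embedding_codes) : CR -> CR := projT1 (cid (svalP y)).
Lemma embeddingP y : coded_by (embedding y) (sval y).
Proof. exact: projT2 (cid (svalP y)). Qed.

Definition embedding_range (y : seqspace embedding_codes) : SF R :=
  MkSF (closed_coded_range (embeddingP y)) (coded_range0 (embeddingP y)) (coded_range_lin (embeddingP y)).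

(** If h f is in the open set U then so is h' f for all h' whose codes are close
    enough. *)
Lemma borel_embedding_range : borel_map embedding_range.
Proof.
apply: borel_map_effros => U /contR_openP oU; apply: sub_sigma_algebra.
rewrite openE => y /= [_ [[f _ <-] Uf]]; apply/snbhsE.
have [N [e [e0 He]]] := oU _ Uf.
have [k [i Hki]] := coded_by_approx f N (gauge (sval y) N) (divr_gt0 e0 (ltr0n _ 2)).
exists (maxn (code (0, N)) (code (k.+1, i))).+1%N => y' A /=.
exists (embedding y' f); split; first by exists f.
apply: He; apply: (coded_by_local e0 Hki (embeddingP y') (embeddingP y)).
  by symmetry; apply: A; rewrite ltnS leq_maxl.
by symmetry; apply: A; rewrite ltnS leq_maxr.
Qed.

Lemma SF_eq (X X' : SF R) : SF_set X = SF_set X' -> X = X'.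
Proof.
case: X => X c0 z0 l0; case: X' => X' c1 z1 l1 /= E; subst X'.
by congr MkSF; exact: Prop_irrelevance.
Qed.

Lemma coded_range_iso h y (X : SF R) : coded_by h y -> SF_set X = range h -> iso_ops (SFspace X) lineC.
Proof.
move=> g XE; have [hl h1 h2 _] := g.
have hinj u v : h u = h v -> u = v.
  move=> E; apply/eqP; rewrite -subr_eq0; apply/eqP/bndC0_eq => N e e0.
  apply: (@bndC_le _ N ((gauge y N)%:R * 0)); first by rewrite mulr0 ltW.
  by apply: h2; rewrite (coded_byB _ _ g) E subrr => t _; rewrite contR0E normr0.
have H f : exists u, SF_set X f -> h u = f.
  have [Xf|nX] := pselect (SF_set X f); last by exists 0.
  by move: (Xf); rewrite XE => -[u _ hu]; exists u.
have [k Hk] := choice H.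
have Xh u : SF_set X (h u) by rewrite XE; exists u.
have kh u : k (h u) = u by apply: hinj; exact: Hk.
exists k, h; split.
- split=> //.
    move=> a u v Xu Xv; apply: hinj; rewrite hl !Hk //; exact: SF_lin.
  move=> n; exists (gauge (y) n), (gauge y n)%:R; split=> // c u Xu bu.
  by apply: h2; rewrite Hk.
- split; [by move=> u _; exact: Xh|by move=> a u v _ _; exact: hl|].
  by move=> n; exists (gauge y n), (gauge y n)%:R; split=> // c u _; exact: h1.
- by move=> f Xf; exact: Hk.
- by move=> f _; exact: kh.
Qed.

Lemma iso_coded_range (X : SF R) : iso_ops (SFspace X) lineC -> exists h y, coded_by h y /\ SF_set X = range h.
Proof.
move=> [u [v [ou ov vu uv]]].
have H n : exists p : nat, (forall c f, bndC p c f -> bndC n (p%:R * c) (v f)) /\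
    (forall c f, bndC p c (v f) -> bndC n (p%:R * c) f).
  have [_ _ /(_ n)[m [C [C0 HC]]]] := ov.
  have [_ _ /(_ n)[m' [C' [C'0 HC']]]] := ou.
  pose M := maxn (maxn m m') (maxn (Num.truncn C).+1 (Num.truncn C').+1).
  have CM : C <= M%:R.
    apply: (@le_trans _ _ (Num.truncn C).+1%:R); first exact/ltW/truncnS_gt.
    by rewrite ler_nat !leq_max leqnn !orbT.
  have CM' : C' <= M%:R.
    apply: (@le_trans _ _ (Num.truncn C').+1%:R); first exact/ltW/truncnS_gt.
    by rewrite ler_nat !leq_max leqnn !orbT.
  have mM : (m <= M)%N by rewrite !leq_max leqnn.
  have mM' : (m' <= M)%N by rewrite !leq_max leqnn !orbT.
  exists M; split=> c f bf; have c0 := bndC_ge0 bf.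
    apply: (@bndC_le _ n (C * c)); first exact: ler_wpM2r.
    by apply: HC => //; exact: bndC_lev bf.
  apply: (@bndC_le _ n (C' * c)); first exact: ler_wpM2r.
  have -> : f = u (v f) by rewrite uv.
  apply: HC'; [exact: (op_dom ov)|exact: bndC_lev bf].
have [p Hp] := choice H.
have K (ki : nat * nat) : exists j, bndC ki.2 (r ki.2) (v (dseq ki.1) - dseq j).
  by apply: dseq_dense; exact: hpow_gt0.
have [q Hq] := choice K.
pose y n := if (unc n).1 is k.+1 then q (k, (unc n).2) else p (unc n).2.
have phiE n : gauge y n = p n by rewrite /gauge /y codeK.
have appE k i : approx y k i = q (k, i) by rewrite /approx /y codeK.
exists v, y; split.
  split.
  - by move=> a f g; exact: (op_lin ov).
  - by move=> n c f; rewrite phiE; have [+ _] := Hp n; apply.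
  - by move=> n c f; rewrite phiE; have [_] := Hp n; apply.
  - by move=> k i; rewrite appE; exact: (Hq (k, i)).
apply/seteqP; split=> f.
  by move=> Xf; exists (u f) => //; exact: vu.
by move=> [g _ <-]; exact: (op_dom ov).
Qed.

Lemma range_embedding_range : range embedding_range = iso_class (SFT R).
Proof.
apply/seteqP; split=> X.
  move=> [y _ <-]; apply/iso_ops_lin_isomorphic.
  exact: (coded_range_iso (embeddingP y)).
move=> /iso_ops_lin_isomorphic /iso_coded_range [h [y [g XE]]].
have Py : embedding_codes y by exists h.
exists (exist _ y Py : seqspace embedding_codes) => //; apply: SF_eq => /=; rewrite XE.
have E := coded_by_uniq (embeddingP (exist _ y Py : seqspace embedding_codes)) g.
by apply/seteqP; split=> _ [f _ <-]; exists f.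
Qed.

Lemma iso_class_analytic : analytic_borel R (iso_class (SFT R)).
Proof.
exists (seqspace embedding_codes : topologicalType), embedding_range; split.
- by apply: seqspace_polish; exact: embedding_codes_closed.
- exact: borel_embedding_range.
- exact: range_embedding_range.
Qed.

End IsoClassAnalytic.

Theorem theorem4p7 (R : realType) :
  complete_analytic R (iso_class (SFT R)).
Proof.
split; last exact: iso_class_hard.
have [code [unc [codeK _]]] := nat_pairing.
exact: iso_class_analytic codeK.
Qed.
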